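(* Let $\mu$ be a Boolean selfdecomposable probability measure on $\mathbb{R}$, let $k_\mu:\mathbb{R}\setminus\{0\}\to[0,\infty)$ be the associated function (chosen unimodal with mode $0$), and assume that $k_\mu$ is not identically equal to zero. Let $\alpha:=\inf\{x\in\mathbb{R}\setminus\{0\}:k_\mu(x)\neq 0\}\in[-\infty,0]$ and $\beta:=\sup\{x\in\mathbb{R}\setminus\{0\}:k_\mu(x)\neq 0\}\in[0,\infty]$. Then: (1) $\mu|_{(\alpha,\beta)}$ is absolutely continuous with respect to the Lebesgue measure. (2) If $\alpha>-\infty$, then $\mu|_{(-\infty,\alpha]}$ is the zero measure or a positive multiple of a Dirac measure. Likewise, if $\beta<\infty$, then $\mu|_{[\beta,\infty)}$ is the zero measure or a positive multiple of a Dirac measure. (3) $\mu(\{0\})=0$. In particular, $\mu$ has no singular continuous part with respect to the Lebesgue measure and has at most two atoms.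
   Context: For a Borel probability measure $\mu$ on $\mathbb{R}$ put $G_\mu(z)=\int_{\mathbb{R}}\frac{1}{z-x}\,\mu(dx)$, $F_\mu(z)=1/G_\mu(z)$ and $K_\mu(z)=z-F_\mu(z)$ for $z$ in the open upper half-plane $\mathbb{C}^+$. There is a unique pair $(b,\tau)$, with $b\in\mathbb{R}$ and $\tau$ a finite positive measure on $\mathbb{R}$, such that $K_\mu(z)=b+\int_{\mathbb{R}}\frac{1+xz}{z-x}\,\tau(dx)$ for $z\in\mathbb{C}^+$; conversely every such pair arises from a unique probability measure. The Boolean Lévy measure of $\mu$ is $\nu(dx)=\frac{1+x^2}{x^2}\mathbf{1}_{\mathbb{R}\setminus\{0\}}(x)\,\tau(dx)$. Writing $\nu^{\rm ac}$ for the Lebesgue absolutely continuous part of $\nu$, define $k_\mu(x)=|x|\frac{d\nu^{\rm ac}}{dx}(x)$ for $x\in\mathbb{R}\setminus\{0\}$ (defined up to Lebesgue-null sets). The Boolean convolution $\mu\uplus\nu$ of two probability measures is the probability measure with $K_{\mu\uplus\nu}=K_\mu+K_\nu$ on $\mathbb{C}^+$. For $c\in\mathbb{R}$, $D_c(\mu)$ is the push-forward of $\mu$ by $x\mapsto cx$. A probability measure $\mu$ on $\mathbb{R}$ is Boolean selfdecomposable if for every $c\in(0,1)$ there is a probability measure $\mu_c$ on $\mathbb{R}$ with $\mu=D_c(\mu)\uplus\mu_c$. For Boolean selfdecomposable $\mu$, the Boolean Lévy measure is Lebesgue absolutely continuous and $k_\mu$ has a version that is unimodal with mode $0$, i.e.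 non-decreasing on $(-\infty,0)$ and non-increasing on $(0,\infty)$; $k_\mu$ is always taken to be such a version. *)

(* Defs.v *)
From HB Require Import structures.
From mathcomp Require Import all_boot all_order all_algebra.
From mathcomp Require Import complex.
From mathcomp Require Import all_classical all_reals all_analysis measurable_realfun.
Set Implicit Arguments.
Unset Strict Implicit.
Unset Printing Implicit Defensive.
Import Order.TTheory GRing.Theory Num.Theory.
Import numFieldNormedType.Exports.
Local Open Scope classical_set_scope.
Local Open Scope ring_scope.
Local Open Scope complex_scope.

Section Transforms.
Context {R : realType}.
Local Notation B := (measurableTypeR R).

(* Integral over R of a complex-valued function. The integrands below are
   continuous and bounded in x when 0 < Im z, hence integrable for finite m. *)
Definition cintegral (m : {measure set B -> \bar R}) (f : R -> R[i]) : R[i] :=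
  (\int[m]_x complex.Re (f x)) +i* (\int[m]_x complex.Im (f x)).

Definition upper_half_plane : set R[i] := [set z | 0 < complex.Im z].

Definition Cauchy_transform (m : {measure set B -> \bar R}) (z : R[i]) :=
  cintegral m (fun x => (z - x%:C)^-1).

Definition F_transform (m : {measure set B -> \bar R}) (z : R[i]) :=
  (Cauchy_transform m z)^-1.

Definition K_transform (m : {measure set B -> \bar R}) (z : R[i]) :=
  z - F_transform m z.

Definition boolean_pair (mu : probability B R) (b : R)
    (tau : {finite_measure set B -> \bar R}) :=
  forall z, upper_half_plane z ->
    K_transform mu z =
    b%:C + cintegral tau (fun x => (1 + x%:C * z) / (z - x%:C)).

(* rho is the Boolean convolution of mu and nu *)
Definition is_boolean_convolution (mu nu rho : probability B R) :=
  forall z, upper_half_plane z ->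
    K_transform rho z = K_transform mu z + K_transform nu z.

Definition scale (c : R) : B -> B := fun x : R => c * x.

Lemma measurable_scale c : measurable_fun setT (scale c).
Proof. exact: mulrl_measurable. Qed.

HB.instance Definition _ c :=
  isMeasurableFun.Build _ _ B B (scale c) (measurable_scale c).

Definition dilation (c : R) (mu : probability B R) : probability B R :=
  distribution mu (scale c).

Definition boolean_selfdecomposable (mu : probability B R) :=
  forall c : R, 0 < c < 1 ->
    exists mu_c : probability B R,
      is_boolean_convolution (dilation c mu) mu_c mu.

End Transforms.

Section LevyMeasure.
Context {R : realType}.
Local Notation B := (measurableTypeR R).
Local Notation leb := (@lebesgue_measure R).

Definition is_boolean_levy_measure (mu : probability B R)
    (nu : {measure set B -> \bar R}) :=
  exists b (tau : {finite_measure set B -> \bar R}),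
    boolean_pair mu b tau /\
    forall A, measurable A ->
      nu A = (\int[tau]_(x in A `\ 0%R) ((1 + x ^+ 2) / x ^+ 2)%:E)%E.

Definition lebesgue_singular (m : {measure set B -> \bar R}) :=
  exists N : set B, [/\ measurable N, leb N = 0%E & m (~` N) = 0%E].

(* nu_ac is the absolutely continuous part in the Lebesgue decomposition of nu *)
Definition is_ac_part (nu nu_ac : {measure set B -> \bar R}) :=
  nu_ac `<< leb /\
  exists nu_s : {measure set B -> \bar R},
    lebesgue_singular nu_s /\
    forall A, measurable A -> nu A = (nu_ac A + nu_s A)%E.

Definition is_lebesgue_density (m : {measure set B -> \bar R})
    (f : B -> \bar R) :=
  [/\ measurable_fun setT f, (forall x, (0 <= f x)%E) &
      forall A, measurable A -> m A = (\int[leb]_(x in A) f x)%E].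

(* k is a version of k_mu; its value at 0 is irrelevant. *)
Definition is_k_function (mu : probability B R) (k : R -> R) :=
  exists nu nu_ac : {measure set B -> \bar R}, exists f : B -> \bar R,
    [/\ is_boolean_levy_measure mu nu, is_ac_part nu nu_ac,
        is_lebesgue_density nu_ac f,
        forall x, x != 0 -> 0 <= k x &
        {ae leb, forall x : R, x != 0 -> (k x)%:E = (`|x|%:E * f x)%E}].

Definition unimodal0 (k : R -> R) :=
  {in `]-oo, 0[ &, {homo k : x y / x <= y}} /\
  {in `]0, +oo[ &, {homo k : x y /~ x <= y}}.

Definition k_support (k : R -> R) : set R := [set x | x != 0 /\ k x != 0].

Definition k_inf (k : R -> R) : \bar R := ereal_inf (EFin @` k_support k).
Definition k_sup (k : R -> R) : \bar R := ereal_sup (EFin @` k_support k).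

End LevyMeasure.

Section Restrictions.
Context {R : realType}.
Local Notation B := (measurableTypeR R).

(* The trace on R of an interval whose endpoints are extended reals. *)
Definition real_itv (i : interval (\bar R)) : set B := EFin @^-1` [set` i].

Lemma measurable_real_itv i : measurable (real_itv i).
Proof.
rewrite /real_itv -[X in measurable X]setTI.
by apply: EFin_measurable => //; exact: emeasurable_itv.
Qed.

Definition restrict_to_itv (mu : {measure set B -> \bar R})
    (i : interval (\bar R)) : {measure set B -> \bar R} :=
  mrestr mu (measurable_real_itv i).

Definition zero_or_dirac_multiple (m : {measure set B -> \bar R}) :=
  (forall A, measurable A -> m A = 0%E) \/
  exists a c : R, 0 < c /\
    forall A : set B, measurable A -> m A = (c%:E * \d_a A)%E.

Definition no_atom (m : {measure set B -> \bar R}) := forall x : R, m [set x] = 0%E.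

Definition purely_atomic (m : {measure set B -> \bar R}) :=
  exists C : set B, countable C /\ m (~` C) = 0%E.

Definition is_singular_continuous_part (mu m : {measure set B -> \bar R}) :=
  [/\ lebesgue_singular m, no_atom m &
   exists m_ac m_d : {measure set B -> \bar R},
    [/\ m_ac `<< (@lebesgue_measure R), purely_atomic m_d &
    forall A, measurable A -> mu A = (m_ac A + m A + m_d A)%E]].

Definition atoms (mu : {measure set B -> \bar R}) : set R :=
  [set x | mu [set x] != 0%E].

End Restrictions.

(* Main.v *)
Require Import Defs.
From mathcomp Require Import all_boot all_order all_algebra.
From mathcomp Require Import complex.
From mathcomp Require Import all_classical all_reals all_analysis.
From mathcomp Require Import ring lra measurable_realfun.
Import Order.TTheory GRing.Theory Num.Theory.
Import numFieldNormedType.Exports.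
Local Open Scope classical_set_scope.
Local Open Scope ring_scope.
Set Implicit Arguments.
Unset Strict Implicit.
Unset Printing Implicit Defensive.

(** Write [F = 1 / G] for the reciprocal Cauchy transform of [mu], and let
    [F(z) = z - b - int (1 + x z) / (z - x) tau(dx)] be its Nevanlinna form.
    Everything rests on the two identities
      [Im F(u + i y) = y + int y (1 + x^2) / ((u - x)^2 + y^2) tau(dx)]  and
      [- Im G = Im F / |F|^2],
    together with the remark that [mu [u - y, u + y] <= 2 y (- Im G(u + i y))].
    Only quantitative estimates for small [y > 0] are used, never boundary
    values of analytic functions.

    - Selfdecomposability turns into [c P(z / c) <= P(z)] for [P = Im F - Im z]
      and [0 < c < 1] (selfdec_kim), because the cofactor [mu_c] satisfies
      [Im F >= Im z].  Averaging this inequality over about [1 / y] dilations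
      bounds [P] near the real axis away from [0] (kim_bound), so [tau] does not
      charge Lebesgue-null sets off [0] (tau_null_off0).  Hence, off [0], [tau]
      vanishes wherever [k] does (tau_null_of_k0), in particular outside
      [[alpha, beta]].

    - Inside [(alpha, beta)] and away from [0], unimodality bounds [k] from
      below, hence [Im F] from below, hence [- Im G <= 1 / Im F] from above, and
      [mu] is absolutely continuous there (mu_null_of_k_pos).  At [0] the Levy
      measure [k(x) / |x| dx] has infinite mass on one side, so that
      [Im F(i y) / y] is unbounded and [mu {0} = 0] (mu_atom0).

    - On compact parts of an open interval not charged by [tau], [Im F = O(y)] and
      [Re F] increases with slope at least [1] up to a small error (kre_diff).
      If [mu] charges a set there, [F] gets arbitrarily close to [0] on that set
      (f_vanishes_on_charged), and so it does at an atom (f_vanishes_at_atom);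
      two sets separated by a gap cannot both have this property
      (f_vanishes_once).  So [mu] is carried by at most one point of each of the
      two outer half-lines
      (zero_or_dirac_off_support).

    The statements on the singular continuous part and on the number of atoms
    follow by cutting the line at [alpha] and [beta]. *)

(** * Measures on the line *)

Section MeasureLemmas.
Context {R : realType}.
Local Notation B := (measurableTypeR R).
Local Notation leb := (@lebesgue_measure R).
Implicit Type m : {measure set B -> \bar R}.

(** Cut [[p, p + n y]] into cells of length [y]: a cell that meets [E] lies in the
    window of radius [y] around any of its points of [E]. *)
Lemma measure_le_cells m (c p y : R) (n : nat) (E : set B) :
  0 <= c -> 0 <= y -> measurable E -> E `<=` `[p, p + n%:R * y]%classic ->
  (forall s : R, E s -> (m `[(s - y)%R, (s + y)%R]%classic <= c%:E)%E) ->
  (m E <= (n.+1%:R * c)%:E)%E.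
Proof.
move=> c0 y0.
have cell (q : R) (A : set B) : measurable A -> A `<=` `[q, q + y]%classic ->
    (forall s : R, A s -> (m `[(s - y)%R, (s + y)%R]%classic <= c%:E)%E) ->
    (m A <= c%:E)%E.
  move=> mA Aq Ac.
  have [[s As]|/nonemptyPn ->] := pselect (A !=set0); last first.
    by rewrite measure0 lee_fin.
  apply: le_trans (Ac _ As); apply: le_measure; rewrite ?inE//=.
  move=> t /Aq; have := Aq _ As; rewrite /= !in_itv/=; lra.
elim: n E => [|n IH] E mE Esub Ec.
  rewrite mul1r; apply: (cell p) => //; apply: subset_trans Esub _.
  by move=> t /=; rewrite !in_itv/=; lra.
pose H : set B := `]-oo, p + n%:R * y]%classic.
have mH : measurable H by exact: measurable_itv.
rewrite -(setUIDK E H) (le_trans (measureU2 _ _ _))//.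
- exact: measurableI.
- exact: measurableD.
rewrite -[n.+2]addn1 natrD mulrDl mul1r EFinD; apply: leeD.
  apply: IH; first exact: measurableI.
    move=> t [/Esub]; rewrite /H /= !in_itv/=; lra.
  by move=> s [/Ec].
apply: (cell (p + n%:R * y)); first exact: measurableD.
  move=> t [/Esub]; rewrite /H /= !in_itv/= -addn1 natrD => tp /negP; lra.
by move=> s [/Ec].
Qed.

(** A null set has covers by open intervals of arbitrarily small total length,
    and [m] charges the part of each in [[p, r]] by at most [|M|] times its
    length. *)
Lemma null_of_interval_bound m (p r M : R) (N : set B) :
  (forall a b, p <= a -> a <= b -> b <= r ->
     (m `[a, b]%classic <= (M * (b - a))%:E)%E) ->
  measurable N -> leb N = 0%E -> N `<=` `[p, r]%classic -> m N = 0%E.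
Proof.
move=> mle mN N0 Npr.
apply/eqP; rewrite eq_le measure_ge0 andbT; apply/lee_addgt0Pr => e e0.
rewrite add0e.
have [[x Nx]|/nonemptyPn ->] := pselect (N !=set0); last first.
  by rewrite measure0 lee_fin ltW.
(* The added [1] makes division by the constant possible. *)
have M0 : 0 <= `|M| + 1 by rewrite addr_ge0.
have Mgt0 : 0 < `|M| + 1 by rewrite ltr_wpDl.
have [_ [F [Fo NF] <-] Fe] : exists2 z,
    [set (\sum_(k <oo) @wlength R idfun (F k))%E | F in open_itv_cover N] z &
    (z < (e / (`|M| + 1))%:E)%E.
  apply: ereal_inf_lt; rewrite -outer_measure_open_itv_cover.
  by rewrite [X in (X < _)%E]N0 lte_fin divr_gt0.
have mF k : measurable (F k : set B).
  by have [[a b] /= ->] := Fo k; exact: measurable_itv.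
have mFN k : measurable (F k `&` `[p, r]%classic : set B) by exact: measurableI.
apply: (@le_trans _ _ (\sum_(k <oo) m (F k `&` `[p, r]%classic))%E).
  apply: measure_sigma_subadditive => // t Nt.
  by have [k _ Fkt] := NF _ Nt; exists k => //; split => //; exact: Npr.
apply: (@le_trans _ _ (\sum_(k <oo) (`|M| + 1)%:E * @wlength R idfun (F k))%E).
  apply: lee_nneseries => // k _.
  have [[a b] /= Fk] := Fo k.
  rewrite Fk wlength_itv/=.
  have [ab|ba] := ltP a b; last first.
    rewrite set_itv_ge ?bnd_simp -?leNgt// set0I measure0.
    by rewrite lte_fin ltNge ba mule0.
  rewrite lte_fin ab -EFinD -EFinM.
  have [pr|rp] := leP (Num.max a p) (Num.min b r); last first.
    rewrite (_ : _ `&` _ = set0).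
      by rewrite measure0 lee_fin mulr_ge0 ?subr_ge0 ?(ltW ab).
    rewrite -subset0 => t /= []; rewrite !in_itv/= => /andP[at_ tb] /andP[pt tr].
    move: rp; apply/negP; rewrite -leNgt; apply: (@le_trans _ _ t).
      by rewrite ge_max pt ltW.
    by rewrite le_min tr ltW.
  apply: (@le_trans _ _ (m `[(Num.max a p)%R, (Num.min b r)%R]%classic)).
    apply: le_measure; rewrite ?inE//=.
      by rewrite -Fk.
    move=> t /= []; rewrite !in_itv/= => /andP[at_ tb] /andP[pt tr].
    by rewrite ge_max le_min pt tr !ltW.
  apply: le_trans (mle _ _ _ _ _) _ => //.
  - by rewrite le_max lexx orbT.
  - by rewrite ge_min lexx orbT.
  rewrite lee_fin; apply: (@le_trans _ _ (`|M| * (b - a))); last first.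
    by rewrite ler_wpM2r ?lerDl ?subr_ge0 ?(ltW ab).
  apply: (@le_trans _ _ (`|M| * (Num.min b r - Num.max a p))).
    by rewrite ler_wpM2r ?subr_ge0 ?ler_norm.
  by rewrite ler_wpM2l// lerB// ?ge_min ?le_max lexx.
rewrite nneseriesZl; last by move=> k _; exact: wlength_ge0.
by rewrite muleC -lee_pdivlMr// ltW.
Qed.

Lemma null_bigcup m (F : (set B)^nat) (A : set B) :
  (forall k, measurable (F k)) -> measurable A -> A `<=` \bigcup_k F k ->
  (forall k, m (F k) = 0%E) -> m A = 0%E.
Proof.
move=> mF mA AF F0; apply/eqP; rewrite -measure_le0.
rewrite (le_trans (measure_sigma_subadditive m mF mA AF))//.
by rewrite eseries0.
Qed.

Lemma null_subset m (A C : set B) :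
  measurable A -> measurable C -> A `<=` C -> m C = 0%E -> m A = 0%E.
Proof.
by move=> mA mC AC C0; apply/eqP; rewrite -measure_le0 -C0 le_measure ?inE.
Qed.

(** The only candidate for the atom is the infimum of the points below which [m]
    has mass: mass strictly above it would be separated by a gap from the mass
    arbitrarily close to it. *)
Lemma zero_or_dirac_of_gap m : (m setT < +oo)%E ->
  (forall a b, a < b -> m `]-oo, a]%classic = 0%E \/ m `[b, +oo[%classic = 0%E) ->
  zero_or_dirac_multiple m.
Proof.
move=> mfin gap.
have [m0|mN0] := eqVneq (m setT) 0%E.
  by left=> A mA; exact: (@null_subset _ _ setT).
pose S : set R := [set x | m `]-oo, x]%classic != 0%E].
have S0 : S !=set0.
  apply/not_existsP => S0; move/eqP: mN0; apply.
  apply: (@null_bigcup _ (fun n => `]-oo, n%:R]%classic)) => //.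
    move=> t _ /=; exists (Num.trunc `|t|).+1 => //=.
    by rewrite in_itv/= (le_trans (ler_norm _))// ltW// truncnS_gt.
  by move=> n; have /negP/negPn/eqP := S0 n%:R.
have Sl : has_lbound S.
  apply/not_existsP => Sl; move/eqP: mN0; apply.
  apply: (@null_bigcup _ (fun n => `[- n%:R, +oo[%classic)) => //.
    move=> t _ /=; exists (Num.trunc `|t|).+1 => //=.
    rewrite in_itv/= andbT lerNl (le_trans _ (ltW (truncnS_gt _)))//.
    by rewrite -normrN ler_norm.
  move=> n; have /existsNP[x /not_implyP[Sx /negP]] := Sl (- n%:R).
  rewrite -ltNge => xn; have [mx|//] := gap _ _ xn.
  by move/eqP : Sx.
pose x0 := inf S.
have Lx0 : m `]-oo, x0[%classic = 0%E.
  apply: (@null_bigcup _ (fun n => `]-oo, x0 - n.+1%:R^-1]%classic)) => //.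
    move=> t /=; rewrite in_itv/= => tx.
    exists (Num.trunc (x0 - t)^-1) => //=; rewrite in_itv/= lerBrDl -lerBrDr.
    rewrite invf_ple ?posrE ?subr_gt0//.
    by rewrite ltW// truncnS_gt.
  move=> n; apply/eqP/negPn/negP => h.
  have /(ge_inf Sl) : S (x0 - n.+1%:R^-1) by [].
  by apply/negP; rewrite -ltNge ltrBlDr ltrDl invr_gt0 ltr0n.
have Rx0 : m `]x0, +oo[%classic = 0%E.
  apply: (@null_bigcup _ (fun n => `[x0 + n.+1%:R^-1, +oo[%classic)) => //.
    move=> t /=; rewrite in_itv/= andbT => tx.
    exists (Num.trunc (t - x0)^-1) => //=; rewrite in_itv/= andbT -lerBrDl.
    rewrite invf_ple ?posrE ?subr_gt0//.
    by rewrite ltW// truncnS_gt.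
  move=> n; have hx : x0 < x0 + n.+1%:R^-1 by rewrite ltrDl invr_gt0 ltr0n.
  have [a Sa ax] := inf_lt S0 hx.
  have [ma|//] := gap _ _ ax.
  by move: Sa; rewrite /S /= ma eqxx.
have mx0 (A : set B) : measurable A -> m A = m (A `&` [set x0]).
  move=> mA; apply/eqP; rewrite eq_le; apply/andP; split; last first.
    by rewrite le_measure ?inE//; exact: measurableI.
  rewrite -{1}(setUIDK A [set x0]) (le_trans (measureU2 _ _ _))//.
  - exact: measurableI.
  - exact: measurableD.
  rewrite [X in (_ + X)%E](_ : _ = 0%E) ?adde0//.
  apply: (@null_subset _ _ (`]-oo, x0[%classic `|` `]x0, +oo[%classic)).
  - exact: measurableD.
  - exact: measurableU.
  - move=> t [_ /=]; rewrite !in_itv/= andbT => /eqP; rewrite neq_lt.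
    by move=> /orP[]; [left|right].
  apply/eqP; rewrite -measure_le0 (le_trans (measureU2 _ _ _))//.
  by rewrite [X in (X + _)%E]Lx0 [X in (_ + X)%E]Rx0 adde0.
have mTx0 := mx0 setT measurableT; rewrite setTI in mTx0.
have mx0fin : m [set x0] \is a fin_num by rewrite -mTx0 ge0_fin_numE.
right; exists x0, (fine (m [set x0])); split.
  by rewrite fine_gt0// -mTx0 mfin lt0e mN0 measure_ge0.
move=> A mA; rewrite mx0// fineK// diracE.
have [xA|xA] := boolP (x0 \in A).
  rewrite mule1; congr (m _); apply/seteqP; split => t [] //.
  by move=> ->; split => //; exact: set_mem.
rewrite mule0 (_ : _ `&` _ = set0) ?measure0//.
by rewrite -subset0 => t [At /= tx]; rewrite tx in At; rewrite mem_set in xA.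
Qed.

End MeasureLemmas.

(** * Kernels and their integrability *)

Section Kernels.
Context {R : realType}.
Local Notation B := (measurableTypeR R).
Implicit Type tau : {finite_measure set B -> \bar R}.

(** [|z - x|^2] for [z = u + i y]. *)
Definition sqd (u y x : R) : R := (u - x) ^+ 2 + y ^+ 2.

Lemma sqd_gt0 (u x y : R) : 0 < y -> 0 < sqd u y x.
Proof. by move=> y0; rewrite /sqd ltr_wpDl ?sqr_ge0// exprn_gt0. Qed.

Lemma measurable_sqdV (u y : R) : 0 < y ->
  measurable_fun [set: B] (fun x : B => (sqd u y x)^-1).
Proof.
move=> y0; apply: continuous_measurable_fun => x.
apply: cvgV; first by rewrite gt_eqF ?sqd_gt0.
rewrite /sqd; apply: cvgD; last exact: cvg_cst.
rewrite expr2; under eq_fun do rewrite expr2.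
by apply: cvgM; apply: cvgB => //; exact: cvg_cst.
Qed.

Lemma integrable_bounded tau (f : B -> R) (M : R) :
  measurable_fun setT f -> (forall x, `|f x| <= M) ->
  tau.-integrable setT (EFin \o f).
Proof.
move=> mf fM; apply: measurable_bounded_integrable => //.
  by rewrite fin_num_fun_lty//; exact: fin_num_measure.
exists M; split; first exact: num_real.
by move=> K MK x _; exact: le_trans (fM x) (ltW MK).
Qed.

Lemma integrable_sqdV tau (u y : R) : 0 < y ->
  tau.-integrable setT (EFin \o (fun x : B => (sqd u y x)^-1)).
Proof.
move=> y0; apply: (@integrable_bounded _ _ (y ^- 2)).
  exact: measurable_sqdV.
move=> x; rewrite gtr0_norm ?invr_gt0 ?sqd_gt0//.
by rewrite lef_pV2 ?posrE ?sqd_gt0 ?exprn_gt0// /sqd lerDr sqr_ge0.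
Qed.

(** The weight [1 + x^2] is bounded near [u] and comparable to [(u - x)^2] far
    away; this is what makes the Nevanlinna kernels bounded. *)
Lemma weight_le (u x : R) : 1 + x ^+ 2 <= (1 + 2 * u ^+ 2) + 2 * (u - x) ^+ 2.
Proof. have := sqr_ge0 (x - 2 * u); nra. Qed.

Lemma integrable_weight tau (u y : R) : 0 < y ->
  tau.-integrable setT (EFin \o (fun x : B => (1 + x ^+ 2) / sqd u y x)).
Proof.
move=> y0; apply: (@integrable_bounded _ _ ((1 + 2 * u ^+ 2) / y ^+ 2 + 2)).
  apply: measurable_funM; last exact: measurable_sqdV.
  by apply: measurable_funD => //; exact: measurable_funX.
move=> x; have D0 := sqd_gt0 u x y0; have y2 : 0 < y ^+ 2 by rewrite exprn_gt0.
rewrite ger0_norm ?divr_ge0 ?(ltW D0) ?addr_ge0 ?sqr_ge0//.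
rewrite ler_pdivrMr// (le_trans (weight_le u x))// [leRHS]mulrDl; apply: lerD.
  rewrite mulrAC ler_pdivlMr// ler_wpM2l//; first by have := sqr_ge0 u; lra.
  by rewrite /sqd lerDr sqr_ge0.
by rewrite ler_wpM2l// /sqd lerDl sqr_ge0.
Qed.

Lemma integrable_dominated tau (u y C : R) (f : B -> R) : 0 < y ->
  measurable_fun setT f -> (forall x, `|f x| <= C * ((1 + x ^+ 2) / sqd u y x)) ->
  tau.-integrable setT (EFin \o f).
Proof.
move=> y0 mf fC.
apply: (@le_integrable _ _ _ _ _ measurableT _
  (fun x : B => C%:E * ((1 + x ^+ 2) / sqd u y x)%:E)%E).
- exact/measurable_EFinP.
- move=> x _ /=; rewrite lee_fin (le_trans (fC x))//.
  by rewrite ler_norm.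
- by apply: integrableZl => //; exact: integrable_weight.
Qed.

(** The real part of [(1 + x z) / (z - x)] at [z = u + i y]. *)
Definition kre_kernel (u y x : R) := x + (1 + x ^+ 2) * (u - x) / sqd u y x.

(** The cubic terms of the common numerator cancel, so the kernel is bounded. *)
Lemma kre_kernelE (u y x : R) : 0 < y ->
  kre_kernel u y x = (u * (1 - x ^+ 2) + x * (u ^+ 2 - 1 + y ^+ 2)) / sqd u y x.
Proof.
move=> y0; have := lt0r_neq0 (sqd_gt0 u x y0).
by rewrite /kre_kernel /sqd => D1; field.
Qed.

Lemma integrable_kre tau (u y : R) : 0 < y ->
  tau.-integrable setT (EFin \o (fun x : B => kre_kernel u y x)).
Proof.
move=> y0; apply: (@integrable_dominated _ u y (`|u| + u ^+ 2 + 1 + y ^+ 2)) => //.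
  apply: measurable_funD => //; apply: measurable_funM; last exact: measurable_sqdV.
  apply: measurable_funM; last exact: measurable_funB.
  by apply: measurable_funD => //; exact: measurable_funX.
move=> x; have D0 := sqd_gt0 u x y0; rewrite kre_kernelE//.
rewrite normrM normfV (gtr0_norm D0) mulrA ler_pM2r ?invr_gt0//.
have x2 := sqr_ge0 x; have u2 := sqr_ge0 u; have y2 := sqr_ge0 y.
rewrite -!addrA mulrDl (le_trans (ler_normD _ _))// !normrM lerD//.
  by rewrite ler_wpM2l// ler_norml; lra.
rewrite mulrC ler_pM// ler_norml; first by lra.
by have := sqr_ge0 (x - 1); have := sqr_ge0 (x + 1); rewrite !expr2 in x2 *; nra.
Qed.

Lemma integrable_gre tau (u y : R) : 0 < y ->
  tau.-integrable setT (EFin \o (fun x : B => (u - x) / sqd u y x)).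
Proof.
move=> y0; apply: (@integrable_bounded _ _ y^-1).
  apply: measurable_funM; last exact: measurable_sqdV.
  exact: measurable_funB.
move=> x; have D0 := sqd_gt0 u x y0.
rewrite normrM normfV (gtr0_norm D0) ler_pdivrMr// mulrC ler_pdivlMr//.
rewrite /sqd -[(u - x) ^+ 2]real_normK ?num_real//.
by have := sqr_ge0 (`|u - x| - y); have := normr_ge0 (u - x); nra.
Qed.

End Kernels.

(** * Real and imaginary parts of the transforms *)

Section Transforms.
Context {R : realType}.
Local Notation B := (measurableTypeR R).
Implicit Types (tau : {finite_measure set B -> \bar R}) (mu : probability B R).
Local Open Scope complex_scope.

(** With [z = u + i y]: the Cauchy transform of [mu] is [gre - i gim], its
    reciprocal is [fre + i fim], and [kre - i kim] is the integral in the
    Nevanlinna form.  The signs are chosen so that [gim], [fim] and [kim] are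
    nonnegative. *)
Definition gre mu (u y : R) : R := \int[mu]_x ((u - x) / sqd u y x).
Definition gim mu (u y : R) : R := y * \int[mu]_x (sqd u y x)^-1.
Definition kre tau (u y : R) : R := \int[tau]_x kre_kernel u y x.
Definition kim tau (u y : R) : R := y * \int[tau]_x ((1 + x ^+ 2) / sqd u y x).

Definition fre mu (u y : R) : R := gre mu u y / (gre mu u y ^+ 2 + gim mu u y ^+ 2).
Definition fim mu (u y : R) : R := gim mu u y / (gre mu u y ^+ 2 + gim mu u y ^+ 2).

Lemma inv_complexE (a b : R) :
  (a +i* b)^-1 = (a / (a ^+ 2 + b ^+ 2)) -i* (b / (a ^+ 2 + b ^+ 2)).
Proof. by []. Qed.

Lemma Cauchy_transformE mu (u y : R) : 0 < y ->
  Cauchy_transform mu (u +i* y) = gre mu u y -i* gim mu u y.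
Proof.
move=> y0; rewrite /Cauchy_transform /cintegral /gre /gim; congr (_ +i* _).
  by apply: eq_Rintegral => x _; rewrite /= /sqd oppr0 addr0.
rewrite -mulNr -RintegralZl//; last exact: integrable_sqdV.
by apply: eq_Rintegral => x _; rewrite /= /sqd !subr0 mulNr.
Qed.

Lemma F_transformE mu (u y : R) : 0 < y ->
  F_transform mu (u +i* y) = fre mu u y +i* fim mu u y.
Proof.
move=> y0; rewrite /F_transform Cauchy_transformE// inv_complexE /fre /fim sqrrN.
by congr (_ +i* _); rewrite mulNr opprK.
Qed.

Lemma K_kernelE (u y x : R) : 0 < y ->
  (1 + x%:C * (u +i* y)) / (u +i* y - x%:C) =
  kre_kernel u y x -i* (y * ((1 + x ^+ 2) / sqd u y x)).
Proof.
move=> y0; have := lt0r_neq0 (sqd_gt0 u x y0); rewrite kre_kernelE// /sqd => D0.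
rewrite [_ - x%:C](_ : _ = (u - x) +i* y); last by congr (_ +i* _); rewrite subr0.
rewrite inv_complexE; apply/eqP; rewrite eq_complex/=.
by apply/andP; split; apply/eqP; field.
Qed.

Lemma boolean_pairE mu b tau : boolean_pair mu b tau ->
  forall u y : R, 0 < y ->
    fre mu u y = u - b - kre tau u y /\ fim mu u y = y + kim tau u y.
Proof.
move=> bp u y y0; have := bp (u +i* y) y0.
rewrite /K_transform F_transformE// /cintegral.
have -> : \int[tau]_x complex.Re ((1 + x%:C * (u +i* y)) / (u +i* y - x%:C)) =
    kre tau u y by apply: eq_Rintegral => x _; rewrite K_kernelE.
have -> : \int[tau]_x complex.Im ((1 + x%:C * (u +i* y)) / (u +i* y - x%:C)) =
    - kim tau u y.
  rewrite /kim -mulNr -RintegralZl//; last exact: integrable_weight.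
  by apply: eq_Rintegral => x _; rewrite K_kernelE//= mulNr.
by move=> /eqP; rewrite eq_complex/= => /andP[/eqP h1 /eqP h2]; split; lra.
Qed.

Lemma integrable_scaleR tau (c : R) (f : B -> R) :
  tau.-integrable setT (EFin \o f) ->
  tau.-integrable setT (EFin \o (fun x => c * f x)).
Proof.
move=> fi; have := integrableZl measurableT c fi.
by apply: eq_integrable => // x _; rewrite /= EFinM.
Qed.

Lemma integrable_addR tau (f g : B -> R) :
  tau.-integrable setT (EFin \o f) -> tau.-integrable setT (EFin \o g) ->
  tau.-integrable setT (EFin \o (fun x => f x + g x)).
Proof. by move=> fi gi; exact: (integrableD measurableT fi gi). Qed.

Lemma integrable_subR tau (f g : B -> R) :
  tau.-integrable setT (EFin \o f) -> tau.-integrable setT (EFin \o g) ->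
  tau.-integrable setT (EFin \o (fun x => f x - g x)).
Proof. by move=> fi gi; exact: (integrableB measurableT fi gi). Qed.

Lemma gim_gt0 mu (u y : R) : 0 < y -> 0 < gim mu u y.
Proof.
move=> y0; rewrite /gim pmulr_rgt0// lt_neqAle andbC; apply/andP; split.
  by apply: Rintegral_ge0 => x _; rewrite invr_ge0 ltW ?sqd_gt0.
apply/eqP => /esym I0.
have mf : measurable_fun [set: B] (EFin \o (fun x : B => (sqd u y x)^-1)).
  by apply/measurable_EFinP; exact: measurable_sqdV.
have : (\int[mu]_x `|((EFin \o (fun x : B => ((sqd u y x)^-1)%R)) x)|)%E = 0%E.
  under eq_integral => x _ do
    rewrite /= gtr0_norm ?invr_gt0 ?sqd_gt0//.
  rewrite -[LHS]fineK; first by congr EFin; exact: I0.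
  exact: (integrable_fin_num measurableT (@integrable_sqdV R mu u y y0)).
move/(ae_eq_integral_abs mu measurableT mf) => [N [mN N0 hN]].
have : mu setT = 0%E.
  apply: (null_subset _ mN _ N0) => // x _; apply: hN => /= h.
  by have := h Logic.I; move=> /eqP; rewrite eqe invr_eq0 gt_eqF ?sqd_gt0.
by rewrite probability_setT => /eqP; rewrite onee_eq0.
Qed.

Lemma fim_gt0 mu (u y : R) : 0 < y -> 0 < fim mu u y.
Proof.
move=> y0; have g0 := gim_gt0 mu u y0.
by rewrite /fim divr_gt0// ltr_wpDl ?sqr_ge0// exprn_gt0.
Qed.

(** [- Im G = Im F / |F|^2], which converts lower bounds on [F] into upper bounds
    on [mu]. *)
Lemma gimE mu (u y : R) : 0 < y ->
  gim mu u y * (fre mu u y ^+ 2 + fim mu u y ^+ 2) = fim mu u y.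
Proof.
move=> y0; have g0 := gim_gt0 mu u y0.
have : gre mu u y ^+ 2 + gim mu u y ^+ 2 != 0.
  by rewrite gt_eqF// ltr_wpDl ?sqr_ge0// exprn_gt0.
by rewrite /fre /fim => N0; field.
Qed.

(** By the Cauchy-Schwarz inequality,
    [|G(z)|^2 <= int |z - x|^(-2) mu(dx) = - Im G(z) / Im z]. *)
Lemma fim_ge mu (u y : R) : 0 < y -> y <= fim mu u y.
Proof.
move=> y0; have g0 := gim_gt0 mu u y0.
have N0 : 0 < gre mu u y ^+ 2 + gim mu u y ^+ 2.
  by rewrite ltr_wpDl ?sqr_ge0// exprn_gt0.
rewrite /fim ler_pdivlMr// [X in _ <= X]/gim ler_pM2l//.
set a := gre _ _ _; set c := gim _ _ _.
(* Integrate |1 / (z - x) - G|^2, expanded with a = Re G and c = - Im G. *)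
have ia := @integrable_gre R mu u y y0.
have ib := @integrable_sqdV R mu u y y0.
have [k kE] : {k | k = a ^+ 2 + c ^+ 2} by exists (a ^+ 2 + c ^+ 2).
have : 0 <= \int[mu]_x ((sqd u y x)^-1 + k -
    (2 * a * ((u - x) / sqd u y x) + (2 * c * y) * (sqd u y x)^-1)).
  apply: Rintegral_ge0 => x _.
  have D0 := sqd_gt0 u x y0; rewrite kE.
  rewrite [X in 0 <= X](_ : _ =
    ((u - x) / sqd u y x - a) ^+ 2 + (y / sqd u y x - c) ^+ 2); last first.
    by rewrite /sqd in D0 *; have := lt0r_neq0 D0 => D1; field.
  by rewrite addr_ge0// sqr_ge0.
have ica : mu.-integrable setT (EFin \o (fun x : B => k)).
  exact: (@finite_measure_integrable_cst _ _ _ mu).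
have i1 := integrable_scaleR (2 * a) ia.
have i2 := integrable_scaleR (2 * c * y) ib.
rewrite RintegralB//; [|exact: integrable_addR..].
rewrite RintegralD// RintegralD//.
rewrite !RintegralZl// -/(gre _ _ _) Rintegral_cst//.
have -> : fine (mu setT) = 1 by rewrite probability_setT.
rewrite mulr1.
have -> : 2 * c * y * \int[mu]_x (sqd u y x)^-1 = 2 * c ^+ 2.
  by rewrite /c /gim; ring.
rewrite -/a -kE; nra.
Qed.

(** [- Im G <= 1 / Im F], written without division. *)
Lemma gim_fim_le1 mu (u y : R) : 0 < y -> gim mu u y * fim mu u y <= 1.
Proof.
move=> y0; have f0 := fim_gt0 mu u y0; have g0 := gim_gt0 mu u y0.
rewrite -(ler_pM2r f0) mul1r -[leRHS](gimE mu u y0) -mulrA -expr2.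
by rewrite ler_pM2l// lerDr sqr_ge0.
Qed.

Lemma kim_ge0 tau (u y : R) : 0 < y -> 0 <= kim tau u y.
Proof.
move=> y0; rewrite /kim mulr_ge0 ?(ltW y0)//; apply: Rintegral_ge0 => x _.
by rewrite divr_ge0 ?addr_ge0 ?sqr_ge0// ltW ?sqd_gt0.
Qed.

End Transforms.

(** * Selfdecomposability as an inequality *)

Section Selfdec.
Context {R : realType}.
Local Notation B := (measurableTypeR R).
Implicit Types (tau : {finite_measure set B -> \bar R}) (mu : probability B R).

(** Markov's inequality. *)
Lemma mass_le_integral tau (A : set B) (f : B -> R) (c : R) :
  0 <= c -> measurable A -> tau.-integrable setT (EFin \o f) ->
  (forall x, 0 <= f x) -> (forall x, A x -> c <= f x) ->
  (c%:E * tau A <= (\int[tau]_x f x)%:E)%E.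
Proof.
move=> c0 mA fi f0 fc.
rewrite /Rintegral fineK; last exact: (integrable_fin_num measurableT fi).
have mf : measurable_fun setT (EFin \o f) by exact: measurable_int fi.
rewrite -integral_cst//.
apply: (@le_trans _ _ (\int[tau]_(x in A) (f x)%:E)%E).
  apply: ge0_le_integral => //.
  by apply: measurable_funS mf.
by apply: ge0_subset_integral => // x _; rewrite lee_fin.
Qed.

Lemma Rintegral_dilation mu (c : R) (f g : B -> R) :
  measurable_fun setT f -> (forall x, f (scale c x) = g x) ->
  mu.-integrable setT (EFin \o g) ->
  \int[dilation c mu]_x f x = \int[mu]_x g x.
Proof.
move=> mf fg gi; rewrite /Rintegral; congr fine.
rewrite (@integral_distribution _ _ _ _ _ mu (scale c) (EFin \o f)).
- by apply: eq_integral => x _ /=; rewrite fg.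
- exact/measurable_EFinP.
- by apply: eq_integrable gi => // x _; rewrite /= fg.
Qed.

Lemma gre_dilation mu (c u y : R) : 0 < c -> 0 < y ->
  gre (dilation c mu) u y = c^-1 * gre mu (u / c) (y / c).
Proof.
move=> c0 y0; have yc : 0 < y / c by rewrite divr_gt0.
rewrite /gre -RintegralZl//; last exact: integrable_gre.
have E (x : R) : (u - c * x) / sqd u y (c * x) =
    c^-1 * ((u / c - x) / sqd (u / c) (y / c) x).
  have := lt0r_neq0 (sqd_gt0 u (c * x) y0).
  have := lt0r_neq0 (sqd_gt0 (u / c) x yc).
  have c1 := lt0r_neq0 c0; rewrite /sqd => D1 D2; field.
  by rewrite c1 /=; move: D2; congr (_ != 0); ring.
apply: Rintegral_dilation => //.
- apply: measurable_funM; last exact: measurable_sqdV.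
  exact: measurable_funB.
- by apply: integrable_scaleR; exact: integrable_gre.
Qed.

Lemma gim_dilation mu (c u y : R) : 0 < c -> 0 < y ->
  gim (dilation c mu) u y = c^-1 * gim mu (u / c) (y / c).
Proof.
move=> c0 y0; have yc : 0 < y / c by rewrite divr_gt0.
have c1 := lt0r_neq0 c0.
have E (x : R) : (sqd u y (c * x))^-1 = c ^- 2 * (sqd (u / c) (y / c) x)^-1.
  have := lt0r_neq0 (sqd_gt0 u (c * x) y0).
  have := lt0r_neq0 (sqd_gt0 (u / c) x yc).
  rewrite /sqd => D1 D2; field.
  by rewrite c1 /=; move: D2; congr (_ != 0); ring.
rewrite /gim (Rintegral_dilation (measurable_sqdV u y0) E).
  by rewrite RintegralZl//; [field|exact: integrable_sqdV].
by apply: integrable_scaleR; exact: integrable_sqdV.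
Qed.

Lemma fim_dilation mu (c u y : R) : 0 < c -> 0 < y ->
  fim (dilation c mu) u y = c * fim mu (u / c) (y / c).
Proof.
move=> c0 y0; have yc : 0 < y / c by rewrite divr_gt0.
rewrite /fim gre_dilation// gim_dilation//.
have := gim_gt0 mu (u / c) yc; move: (gim _ _ _) (gre _ _ _) => g h g0.
have c1 := lt0r_neq0 c0.
have N0 : h ^+ 2 + g ^+ 2 != 0.
  by rewrite gt_eqF// ltr_wpDl ?sqr_ge0// exprn_gt0.
have N1 : (c^-1 * h) ^+ 2 + (c^-1 * g) ^+ 2 != 0.
  by rewrite !exprMn -mulrDr mulf_eq0 negb_or N0 expf_eq0 /= invr_eq0 c1.
by field; rewrite N0 c1.
Qed.

Lemma K_transformE mu (u y : R) : 0 < y ->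
  K_transform mu (Complex u y) = Complex (u - fre mu u y) (y - fim mu u y).
Proof. by move=> y0; rewrite /K_transform F_transformE. Qed.

(** The transform of the dilated measure is [c K(z / c)], and [Im K <= 0] for the
    cofactor. *)
Lemma selfdec_kim mu b tau : boolean_selfdecomposable mu -> boolean_pair mu b tau ->
  forall c u y : R, 0 < c < 1 -> 0 < y ->
    c * kim tau (u / c) (y / c) <= kim tau u y.
Proof.
move=> sd bp c u y c01 y0; have /andP[c0 c1] := c01.
have yc : 0 < y / c by rewrite divr_gt0.
have [muc /(_ (Complex u y) y0)] := sd c c01.
rewrite !K_transformE// => /eqP; rewrite eq_complex/= => /andP[_ /eqP h].
have := fim_ge muc u y0; rewrite fim_dilation// in h.
have [_ h1] := boolean_pairE bp u y0; have [_ h2] := boolean_pairE bp (u / c) yc.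
rewrite h1 h2 mulrDr in h; rewrite -[c * (y / c)]mulrCA divff ?gt_eqF// mulr1 in h.
by lra.
Qed.

End Selfdec.

(** * The Poisson integral near the real axis *)

Section PoissonBound.
Context {R : realType}.
Local Notation B := (measurableTypeR R).
Implicit Type tau : {finite_measure set B -> \bar R}.

(** A bounded increasing function whose unit increments dominate the Cauchy
    kernel of width [1/2], so that sums of that kernel over the integers
    telescope. *)
Definition softsign (t : R) : R := t / (1 + `|t|).

Lemma softsign_bound t : `|softsign t| <= 1.
Proof.
have t1 : 0 < 1 + `|t| by rewrite ltr_wpDr.
by rewrite /softsign normrM normfV (gtr0_norm t1) ler_pdivrMr// mul1r lerDr.
Qed.

Lemma softsign_step t :
  (t ^+ 2 + 4^-1)^-1 <= 10 * (softsign (t + 2^-1) - softsign (t - 2^-1)).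
Proof.
have t2 : 0 < t ^+ 2 + 4^-1 by rewrite ltr_wpDl ?sqr_ge0.
have a1 : 0 < 1 + `|t - 2^-1| by rewrite ltr_wpDr.
have b1 : 0 < 1 + `|t + 2^-1| by rewrite ltr_wpDr.
rewrite /softsign -[_^-1]mul1r ler_pdivrMr//.
rewrite [X in _ <= 10 * X * _](_ : _ =
  ((t + 2^-1) * (1 + `|t - 2^-1|) - (t - 2^-1) * (1 + `|t + 2^-1|)) /
  ((1 + `|t - 2^-1|) * (1 + `|t + 2^-1|))); last first.
  by have := lt0r_neq0 a1; have := lt0r_neq0 b1; move=> *; field; apply/andP.
rewrite mulrA mulrAC ler_pdivlMr ?mulr_gt0// mul1r.
have tt := sqr_ge0 t; rewrite expr2 in t2 tt *.
have [ta|ta] := lerP 0 (t - 2^-1); have [tb|tb] := lerP 0 (t + 2^-1).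
- rewrite (ger0_norm ta) (ger0_norm tb) [X in 10 * X](_ : _ = 1); last by field.
  by have := sqr_ge0 (t - 1); rewrite expr2; lra.
- by exfalso; lra.
- rewrite (ltr0_norm ta) (ger0_norm tb).
  rewrite [X in 10 * X](_ : _ = 3 / 2 - 2 * (t * t)); last by field.
  have h : t * t <= 4^-1 by nra.
  have : (3 / 2 - 2 * (t * t)) * (t * t + 4^-1) >= 1 * 4^-1 by apply: ler_pM; lra.
  lra.
- rewrite (ltr0_norm ta) (ltr0_norm tb) [X in 10 * X](_ : _ = 1); last by field.
  by have := sqr_ge0 (t + 1); rewrite expr2; lra.
Qed.

Lemma sum_cauchy_kernel_le (s : R) n :
  \sum_(j < n) ((s - j%:R) ^+ 2 + 4^-1)^-1 <= 20.
Proof.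
suff H : \sum_(j < n) ((s - j%:R) ^+ 2 + 4^-1)^-1 <=
    10 * (softsign (s + 2^-1) - softsign (s - n%:R + 2^-1)).
  apply: le_trans H _.
  have := softsign_bound (s + 2^-1); have := softsign_bound (s - n%:R + 2^-1).
  rewrite !ler_norml; lra.
elim: n => [|n IH]; first by rewrite big_ord0 subr0 subrr mulr0.
rewrite big_ord_recr/=; have := softsign_step (s - n%:R).
have -> : s - n.+1%:R + 2^-1 = s - n%:R - 2^-1 by rewrite -natr1; lra.
lra.
Qed.

Lemma Rintegral_sum tau n (f : nat -> B -> R) :
  (forall j, (j < n)%N -> tau.-integrable setT (EFin \o f j)) ->
  tau.-integrable setT (EFin \o (fun x => \sum_(j < n) f j x)) /\
  \int[tau]_x (\sum_(j < n) f j x) = \sum_(j < n) \int[tau]_x f j x.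
Proof.
elim: n => [|n IH] fi.
  rewrite big_ord0; under eq_Rintegral do rewrite big_ord0.
  rewrite Rintegral_cst// mul0r; split => //.
  apply: (eq_integrable measurableT (cst 0%E)); last exact: integrable0.
  by move=> x _ /=; rewrite big_ord0.
have [IH1 IH2] := IH (fun j jn => fi j (ltnW jn)).
have fn := fi n (ltnSn n).
have E : (fun x => \sum_(j < n.+1) f j x) = (fun x => \sum_(j < n) f j x + f n x).
  by apply/funext => x; rewrite big_ord_recr.
rewrite E; split; first exact: integrable_addR.
by rewrite RintegralD// IH2 big_ord_recr.
Qed.

(** Sum the hypothesis over the dilations [c = 1 - j y / |u|] for [j < n], where
    [n] is about [|u| / (2 y)]: as [c >= 1 / 2], this gives
    [n / 2 * kim(u, y) <= sum of kim(c u, c y)].  The points [c u] are spaced by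
    [y], so the kernels of [kim] centred there add up to [O(1 / y)]
    uniformly in [x], and [n] is of the order of [1 / y] too. *)
Lemma kim_bound tau (u y : R) :
  (forall c u' y' : R, 0 < c < 1 -> 0 < y' ->
     c * kim tau (u' / c) (y' / c) <= kim tau u' y') ->
  u != 0 -> 0 < y -> y <= `|u| / 4 ->
  kim tau u y <= 8 * fine (tau setT) * (20 + 41 * u ^+ 2) / `|u|.
Proof.
move=> sd u0 y0 yu.
have nu : 0 < `|u| by rewrite normr_gt0.
pose n := Num.trunc (`|u| / (2 * y)).
have n1 : n%:R * (2 * y) <= `|u|.
  by rewrite -ler_pdivlMr ?mulr_gt0// truncn_le// divr_ge0// mulr_ge0// ltW.
have n2 : `|u| / 4 <= n%:R * y.
  have : `|u| / (2 * y) < n.+1%:R by rewrite truncnS_gt.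
  by rewrite ltr_pdivrMr ?mulr_gt0// -natr1; lra.
pose c j : R := 1 - j%:R * y / `|u|.
have cu (j : nat) : (j < n)%N -> c j * u = u - Num.sg u * (j%:R * y).
  move=> _; rewrite /c mulrBl mul1r; congr (_ - _).
  by rewrite {2}[u]numEsg; field; rewrite gt_eqF.
have c1 (j : nat) : (j < n)%N -> 2^-1 <= c j <= 1.
  move=> jn; apply/andP; split.
    rewrite /c lerBrDr -lerBrDl ler_pdivrMr//.
    have : j%:R * y <= n%:R * y by rewrite ler_pM2r// ler_nat ltnW.
    lra.
  by rewrite /c gerBl divr_ge0// mulr_ge0// ltW.
pose f j (x : B) := (c j * y) * ((1 + x ^+ 2) / sqd (c j * u) (c j * y) x).
(* Measured from [u] towards [0] in units of [y], the points [c j * u] are the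
   integers [j] and [x] is [s x]. *)
pose s (x : R) := Num.sg u * (u - x) / y.
pose C := (1 + 2 * u ^+ 2) / y * 20 + n%:R * (2 * y).
have sg2 : Num.sg u ^+ 2 = 1 by rewrite sqr_sg u0.
have K0 (x : R) j : 0 < (s x - j%:R) ^+ 2 + 4^-1 by rewrite ltr_wpDl ?sqr_ge0.
have fle (x : R) j : (j < n)%N ->
    f j x <= (1 + 2 * u ^+ 2) / y * ((s x - j%:R) ^+ 2 + 4^-1)^-1 + 2 * y.
  move=> jn; have /andP[c1a c1b] := c1 j jn.
  have cj0 : 0 < c j by lra.
  have w0 : 0 < c j * y by rewrite mulr_gt0.
  have w1 : c j * y <= y by rewrite ler_piMl// ltW.
  have D0 := sqd_gt0 (c j * u) x w0.
  have DE : y ^+ 2 * ((s x - j%:R) ^+ 2 + 4^-1) <= sqd (c j * u) (c j * y) x.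
    rewrite /sqd mulrDr; apply: lerD.
      rewrite cu// -exprMn mulrBr [y * s x]mulrC /s divfK ?gt_eqF//.
      rewrite [X in X <= _](_ : _ =
        (Num.sg u * (u - Num.sg u * (j%:R * y) - x)) ^+ 2).
        by rewrite exprMn sg2 mul1r.
      congr (_ ^+ 2).
      rewrite [RHS](_ : _ = Num.sg u * (u - x) - Num.sg u ^+ 2 * (j%:R * y)).
        by rewrite sg2; ring.
      by ring.
    rewrite exprMn mulrC ler_wpM2r ?sqr_ge0//.
    by rewrite expr2 (_ : 4^-1 = 2^-1 * 2^-1); [apply: ler_pM|field].
  rewrite /f mulrA ler_pdivrMr//.
  have u2 : (c j * u) ^+ 2 <= u ^+ 2.
    rewrite exprMn ler_piMl ?sqr_ge0// expr_le1//; exact: ltW.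
  apply: (@le_trans _ _ (y * (1 + 2 * u ^+ 2 + 2 * sqd (c j * u) (c j * y) x))).
    apply: ler_pM => //; [exact: ltW|by rewrite addr_ge0// sqr_ge0|].
    rewrite (le_trans (weight_le (c j * u) x))//.
    by rewrite lerD ?lerD2l ?ler_pM2l// /sqd lerDl sqr_ge0.
  rewrite mulrDr [leRHS]mulrDl; apply: lerD; last by rewrite mulrA [y * 2]mulrC.
  rewrite [leRHS](_ : _ = (1 + 2 * u ^+ 2) *
    (sqd (c j * u) (c j * y) x / (y * ((s x - j%:R) ^+ 2 + 4^-1)))); last first.
    by rewrite invfM -!mulrA; congr (_ * _); rewrite [RHS]mulrC -mulrA.
  rewrite mulrC ler_wpM2l//; first by have := sqr_ge0 u; lra.
  by rewrite ler_pdivlMr ?mulr_gt0// mulrA -expr2.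
have fi j : (j < n)%N -> tau.-integrable setT (EFin \o f j).
  move=> jn; have /andP[c1a c1b] := c1 j jn.
  apply: integrable_scaleR; apply: integrable_weight; rewrite mulr_gt0//; lra.
have [sfi sfE] := Rintegral_sum fi.
have I1 : \int[tau]_x (\sum_(j < n) f j x) <= C * fine (tau setT).
  rewrite -Rintegral_cst//; apply: le_Rintegral => //.
    exact: (finite_measure_integrable_cst tau C measurableT).
  move=> x _; apply: (@le_trans _ _ (\sum_(j < n)
      ((1 + 2 * u ^+ 2) / y * ((s x - j%:R) ^+ 2 + 4^-1)^-1 + 2 * y))).
    by apply: ler_sum => j _; exact: fle.
  rewrite big_split/= -mulr_sumr sumr_const card_ord.
  rewrite -[X in _ + X <= _]mulr_natl lerD2r.
  rewrite ler_wpM2l ?sum_cauchy_kernel_le// divr_ge0 ?(ltW y0)//.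
  by have := sqr_ge0 u; lra.
have k0 : 0 <= kim tau u y by exact: kim_ge0.
have I2 : n%:R / 2 * kim tau u y <= \int[tau]_x (\sum_(j < n) f j x).
  rewrite sfE; apply: (@le_trans _ _ (\sum_(j < n) (2^-1 * kim tau u y))).
    by rewrite sumr_const card_ord -[leRHS]mulr_natl mulrA.
  apply: ler_sum => j _; have /andP[c1a c1b] := c1 j (ltn_ord j).
  have cj0 : 0 < c j by lra.
  rewrite /f RintegralZl//; last by apply: integrable_weight; rewrite mulr_gt0.
  rewrite -/(kim tau (c j * u) (c j * y)).
  apply: (@le_trans _ _ (c j * kim tau u y)); first by rewrite ler_wpM2r.
  move: c1b; rewrite le_eqVlt => /predU1P[->|cj1]; first by rewrite !mul1r.
  have := sd (c j) (c j * u) (c j * y); rewrite cj0 cj1 mulr_gt0// => /(_ isT isT).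
  by rewrite ![c j * _ / c j]mulrAC !divff ?gt_eqF// !mul1r.
have T0 : 0 <= fine (tau setT) by rewrite fine_ge0.
have I3 := le_trans I2 I1.
rewrite ler_pdivlMr//.
have I4 : y * (n%:R / 2 * kim tau u y) <= y * (C * fine (tau setT)).
  by rewrite ler_pM2l.
have CE : y * C = (1 + 2 * u ^+ 2) * 20 + (n%:R * (2 * y)) * y.
  by rewrite /C; field; rewrite gt_eqF.
rewrite mulrA CE in I4.
have I5 : (n%:R * (2 * y)) * y <= u ^+ 2.
  rewrite -real_normK ?num_real// expr2; apply: ler_pM => //.
  - by rewrite mulr_ge0// mulr_ge0// ltW.
  - exact: ltW.
  - lra.
have I6 : `|u| / 4 * kim tau u y <= n%:R * y * kim tau u y by rewrite ler_wpM2r.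
have I7 : ((1 + 2 * u ^+ 2) * 20 + (n%:R * (2 * y)) * y) * fine (tau setT) <=
   (20 + 41 * u ^+ 2) * fine (tau setT) by rewrite ler_wpM2r//; lra.
have I8 : y * (n%:R / 2 * kim tau u y) = (n%:R * y * kim tau u y) / 2 by field.
rewrite I8 in I4; lra.
Qed.

End PoissonBound.

(** * Local densities *)

Section LocalBounds.
Context {R : realType}.
Local Notation B := (measurableTypeR R).
Local Notation leb := (@lebesgue_measure R).
Implicit Types (tau : {finite_measure set B -> \bar R}) (mu : probability B R).

Lemma sqd_le (u y x : R) : x \in `[u - y, u + y] -> sqd u y x <= 2 * y ^+ 2.
Proof.
rewrite in_itv/= => /andP[h1 h2]; rewrite /sqd mulr2n mulrDl !mul1r lerD2r.
rewrite -ler_sqrt ?sqr_ge0// !sqrtr_sqr; have y0 : 0 <= y by lra.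
by rewrite (ger0_norm y0) ler_norml; lra.
Qed.

Lemma tau_interval_le tau (u y : R) : 0 < y ->
  (tau `[(u - y)%R, (u + y)%R]%classic <= (2 * y * kim tau u y)%:E)%E.
Proof.
move=> y0; have y2 : 0 < 2 * y ^+ 2 by rewrite mulr_gt0// exprn_gt0.
rewrite (_ : 2 * y * _ =
  2 * y ^+ 2 * \int[tau]_x ((1 + x ^+ 2) / sqd u y x)); last first.
  by rewrite /kim expr2; ring.
rewrite EFinM muleC -lee_pdivrMr// muleC; apply: mass_le_integral => //.
- by rewrite invr_ge0 ltW.
- exact: integrable_weight.
- by move=> x; rewrite divr_ge0 ?addr_ge0 ?sqr_ge0// ltW ?sqd_gt0.
move=> x /= /sqd_le xI; have D0 := sqd_gt0 u x y0.
rewrite -[_^-1]mul1r; apply: ler_pM; rewrite ?invr_ge0 ?(ltW y2)//.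
  by rewrite lerDl sqr_ge0.
by rewrite lef_pV2 ?posrE.
Qed.

Lemma mu_interval_le mu (u y : R) : 0 < y ->
  (mu `[(u - y)%R, (u + y)%R]%classic <= (2 * y * gim mu u y)%:E)%E.
Proof.
move=> y0; have y2 : 0 < 2 * y ^+ 2 by rewrite mulr_gt0// exprn_gt0.
rewrite (_ : 2 * y * _ = 2 * y ^+ 2 * \int[mu]_x (sqd u y x)^-1); last first.
  by rewrite /gim expr2; ring.
rewrite EFinM muleC -lee_pdivrMr// muleC; apply: mass_le_integral => //.
- by rewrite invr_ge0 ltW.
- exact: integrable_sqdV.
- by move=> x; rewrite invr_ge0 ltW ?sqd_gt0.
by move=> x /= /sqd_le xI; rewrite lef_pV2 ?posrE ?sqd_gt0.
Qed.

Lemma mu_atom_le mu (u y : R) : 0 < y ->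
  (mu [set u] <= (y * gim mu u y)%:E)%E.
Proof.
move=> y0; have y2 : 0 < y ^+ 2 by rewrite exprn_gt0.
rewrite (_ : y * _ = y ^+ 2 * \int[mu]_x (sqd u y x)^-1); last first.
  by rewrite /gim expr2; ring.
rewrite EFinM muleC -lee_pdivrMr// muleC; apply: mass_le_integral => //.
- by rewrite invr_ge0 ltW.
- exact: integrable_sqdV.
- by move=> x; rewrite invr_ge0 ltW ?sqd_gt0.
by move=> x /= ->; rewrite /sqd subrr expr0n add0r.
Qed.

(** Cells of length [y] bound the mass of an interval by [2 M] times its length,
    up to an error that disappears as [y] tends to [0]. *)
Lemma null_of_local_bound (m : {measure set B -> \bar R}) (p r M y0 : R)
    (N : set B) :
  0 <= M -> 0 < y0 ->
  (forall s y : R, p <= s -> s <= r -> 0 < y -> y <= y0 ->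
     (m `[(s - y)%R, (s + y)%R]%classic <= (2 * y * M)%:E)%E) ->
  measurable N -> leb N = 0%E -> N `<=` `[p, r]%classic -> m N = 0%E.
Proof.
move=> M0 y00 loc; apply: (@null_of_interval_bound _ _ _ _ (2 * M)) => a b pa ab br.
apply/lee_addgt0Pr => e e0.
(* The cells overshoot by at most [4 M y], which must not exceed [e]. *)
pose y := Num.min y0 (e / (4 * M + 1)).
have M1 : 0 < 4 * M + 1 by lra.
have yp : 0 < y by rewrite lt_min y00 divr_gt0.
have ye : y * (4 * M + 1) <= e by rewrite -ler_pdivlMr// ge_min lexx orbT.
pose n := (Num.trunc ((b - a) / y)).+1.
have n1 : b - a <= n%:R * y by rewrite -ler_pdivrMr// ltW// truncnS_gt.
have n2 : n%:R * y <= b - a + y.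
  rewrite /n -natr1 mulrDl mul1r lerD2r -ler_pdivlMr//.
  by rewrite truncn_le// divr_ge0 ?subr_ge0// ltW.
apply: le_trans (@measure_le_cells _ m (2 * y * M) a y n _ _ _ _ _ _) _ => //.
- by rewrite !mulr_ge0// ltW.
- exact: ltW.
- by move=> t /=; rewrite !in_itv/=; lra.
- move=> s /=; rewrite in_itv/= => /andP[s1 s2]; apply: loc => //.
  + exact: le_trans s1.
  + exact: le_trans br.
  + by rewrite ge_min lexx.
rewrite -EFinD lee_fin -natr1 mulrDl mul1r.
have : n%:R * y * (2 * M) <= (b - a + y) * (2 * M).
  by rewrite ler_wpM2r// mulr_ge0.
lra.
Qed.

Section selfdec.
Variables (mu : probability B R) (b : R) (tau : {finite_measure set B -> \bar R}).
Hypothesis sd : boolean_selfdecomposable mu.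
Hypothesis bp : boolean_pair mu b tau.

Let tau_null_away (p r d : R) (N : set B) :
  0 < d -> (forall s, p <= s -> s <= r -> d <= `|s|) ->
  measurable N -> leb N = 0%E -> N `<=` `[p, r]%classic -> tau N = 0%E.
Proof.
move=> d0 ds.
pose L := `|p| + `|r|.
pose T := fine (tau setT).
have T0 : 0 <= T by rewrite fine_ge0.
pose M := 8 * T * (20 + 41 * L ^+ 2) / d.
have L0 : 0 <= 20 + 41 * L ^+ 2 by have := sqr_ge0 L; lra.
have M0 : 0 <= M by rewrite !mulr_ge0// invr_ge0 ltW.
apply: (@null_of_local_bound _ _ _ M (d / 4)) => //; first by rewrite divr_gt0.
move=> s y ps sr y0 yd; have dn := ds s ps sr.
apply: (le_trans (tau_interval_le tau s y0)).
rewrite lee_fin ler_pM2l ?mulr_gt0//.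
have nd : 0 < `|s| by exact: lt_le_trans dn.
apply: (le_trans (kim_bound _ _ y0 _)).
- by move=> c u' y' c01 y'0; exact: (selfdec_kim sd bp u' c01 y'0).
- by rewrite -normr_gt0.
- by rewrite (le_trans yd)// ler_pM2r.
rewrite /M; apply: ler_pM.
- by rewrite !mulr_ge0//; have := sqr_ge0 s; lra.
- by rewrite invr_ge0 ltW.
- rewrite ler_wpM2l ?mulr_ge0// lerD2l ler_pM2l//.
  rewrite -[s ^+ 2]real_normK ?num_real// lerXn2r ?nnegrE ?addr_ge0//.
  rewrite ler_norml /L; have := ler_norm r; have := ler_norm (- p); rewrite normrN.
  by have := normr_ge0 p; have := normr_ge0 r; lra.
- by rewrite lef_pV2 ?posrE.
Qed.

(** Off [0] the bound on [kim] is locally uniform, so [tau] has a locally bounded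
    density there. *)
Lemma tau_null_off0 (N : set B) :
  measurable N -> leb N = 0%E -> ~ N 0 -> tau N = 0%E.
Proof.
move=> mN N0 N00.
have leb0 (A : set B) : measurable A -> leb (N `&` A) = 0%E.
  by move=> mA; apply: (@null_subset _ _ _ N) => //; exact: measurableI.
pose F (s : bool) (n : nat) : set B := if s then `[n.+1%:R^-1, n.+1%:R]%classic
   else `[- n.+1%:R, - n.+1%:R^-1]%classic.
have mF s n : measurable (F s n) by case: s; exact: measurable_itv.
have FN s n : tau (N `&` F s n) = 0%E.
  have n0 : 0 < n.+1%:R^-1 :> R by rewrite invr_gt0 ltr0n.
  have mNF : measurable (N `&` F s n) by exact: measurableI.
  case: s mNF => mNF.
    apply: (@tau_null_away n.+1%:R^-1 n.+1%:R n.+1%:R^-1) => //.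
    - by move=> s s1 s2; rewrite ger0_norm// (le_trans _ s1)// ltW.
    - exact: leb0 (mF true n).
  apply: (@tau_null_away (- n.+1%:R) (- n.+1%:R^-1) n.+1%:R^-1) => //.
  - move=> s s1 s2; rewrite ltr0_norm; first by rewrite lerNr.
    by rewrite (le_lt_trans s2)// oppr_lt0.
  - exact: leb0 (mF false n).
apply: (@null_bigcup _ _ (fun n => N `&` (F true n `|` F false n))) => //.
- by move=> k; apply: measurableI => //; exact: measurableU.
- move=> t Nt; have t0 : t != 0 by apply/eqP => t0; rewrite t0 in Nt.
  have nt : 0 < `|t| by rewrite normr_gt0.
  pose k := maxn (Num.trunc `|t|) (Num.trunc `|t|^-1).
  have k1 : `|t| <= k.+1%:R.
    by rewrite (le_trans (ltW (truncnS_gt _)))// ler_nat ltnS leq_maxl.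
  have k2 : k.+1%:R^-1 <= `|t|.
    rewrite invf_ple ?posrE ?ltr0n//.
    by rewrite (le_trans (ltW (truncnS_gt _)))// ler_nat ltnS leq_maxr.
  exists k => //; split => //.
  have [tp|tn] := lerP 0 t; [left|right]; rewrite /F /= in_itv/=.
    by rewrite (ger0_norm tp) in k1 k2; rewrite k1 k2.
  by rewrite (ltr0_norm tn) in k1 k2; rewrite lerNl k1 lerNr k2.
- move=> n; rewrite setIUr; apply/eqP; rewrite -measure_le0.
  rewrite (le_trans (measureU2 _ _ _))//; [exact: measurableI..|].
  by rewrite [X in (X + _)%E](FN true n) [X in (_ + X)%E](FN false n) adde0.
Qed.

End selfdec.
End LocalBounds.

(** * Intervals not charged by the representing measure *)

Section Outside.
Context {R : realType}.
Local Notation B := (measurableTypeR R).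
Implicit Types (tau : {finite_measure set B -> \bar R}) (mu : probability B R).

Lemma le_Rintegral_off_null tau (N : set B) (f g : B -> R) :
  measurable N -> tau N = 0%E ->
  tau.-integrable setT (EFin \o f) -> tau.-integrable setT (EFin \o g) ->
  (forall x, ~ N x -> f x <= g x) ->
  \int[tau]_x f x <= \int[tau]_x g x.
Proof.
move=> mN N0 fi gi fg.
have E (h : B -> R) : tau.-integrable setT (EFin \o h) ->
    \int[tau]_x h x = \int[tau]_(x in setT `\` N) h x.
  by move=> hi; rewrite /Rintegral; congr fine; exact: (negligible_integral mN).
have mTN : measurable (setT `\` N) by exact: measurableD.
rewrite !E//; apply: le_Rintegral => //.
- exact: integrableS fi.
- exact: integrableS gi.
- by move=> x [_ /fg].
Qed.

(** The sign condition says that [x] is not between [s] and [t].  The term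
    [- (s - x) (t - x)] then only helps, and what remains is a multiple of [y^2],
    because [(t - s)^2 / 2] is at most the sum of the two squared distances. *)
Lemma kre_kernel_diff (s t x y : R) : 0 < y -> s < t -> 0 <= (s - x) * (t - x) ->
  kre_kernel t y x - kre_kernel s y x <=
  2 * y ^+ 2 / (t - s) * ((1 + x ^+ 2) / sqd s y x + (1 + x ^+ 2) / sqd t y x).
Proof.
move=> y0 st sx.
have Ds := sqd_gt0 s x y0; have Dt := sqd_gt0 t x y0.
have ts : 0 < t - s by lra.
have x2 : 0 < 1 + x ^+ 2 by have := sqr_ge0 x; lra.
have -> : kre_kernel t y x - kre_kernel s y x =
    (1 + x ^+ 2) / (sqd s y x * sqd t y x) *
    ((t - s) * (y ^+ 2 - (s - x) * (t - x))).
  have := lt0r_neq0 Ds; have := lt0r_neq0 Dt; rewrite /kre_kernel /sqd => D1 D2.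
  by field; rewrite D1 D2.
have -> : 2 * y ^+ 2 / (t - s) *
      ((1 + x ^+ 2) / sqd s y x + (1 + x ^+ 2) / sqd t y x) =
    (1 + x ^+ 2) / (sqd s y x * sqd t y x) *
    (2 * y ^+ 2 / (t - s) * (sqd s y x + sqd t y x)).
  have D1 := lt0r_neq0 Ds; have D2 := lt0r_neq0 Dt.
  by field; rewrite D1 D2 gt_eqF.
rewrite ler_pM2l ?divr_gt0 ?mulr_gt0//.
rewrite mulrAC ler_pdivlMr//.
have h1 : (t - s) * (y ^+ 2 - (s - x) * (t - x)) * (t - s) <= (t - s) ^+ 2 * y ^+ 2.
  rewrite mulrAC -expr2 ler_wpM2l ?sqr_ge0//; lra.
apply: le_trans h1 _; rewrite mulrC -[leRHS]mulrA [leRHS]mulrCA.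
rewrite ler_wpM2l ?sqr_ge0//.
by rewrite /sqd; have := sqr_ge0 ((s - x) + (t - x)); have := sqr_ge0 y; nra.
Qed.

(** [Re F] increases from [s] to [t] by at least [t - s], up to the right-hand
    side, when [tau] does not charge [(s, t)]. *)
Lemma kre_diff tau (s t y : R) : 0 < y -> s < t ->
  tau `]s, t[%classic = 0%E ->
  kre tau t y - kre tau s y <= 2 * y / (t - s) * (kim tau s y + kim tau t y).
Proof.
move=> y0 st st0.
rewrite /kre -RintegralB//; [|exact: integrable_kre..].
have is_ := @integrable_weight _ tau s y y0.
have it_ := @integrable_weight _ tau t y y0.
rewrite [leRHS](_ : _ = \int[tau]_x (2 * y ^+ 2 / (t - s) *
    ((1 + x ^+ 2) / sqd s y x + (1 + x ^+ 2) / sqd t y x))); last first.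
  rewrite RintegralZl//; last exact: integrable_addR.
  by rewrite RintegralD// /kim expr2; ring.
apply: (@le_Rintegral_off_null _ `]s, t[%classic) => //.
- by apply: integrable_subR; exact: integrable_kre.
- by apply: integrable_scaleR; exact: integrable_addR.
move=> x /= xN; apply: kre_kernel_diff => //.
move: xN; rewrite in_itv/= => /negP; rewrite negb_and -!leNgt => /orP[h|h].
  by rewrite mulr_ge0// subr_ge0// (le_trans h)// ltW.
by rewrite mulr_le0// subr_le0// (le_trans _ h)// ltW.
Qed.

Lemma kim_le_off_support tau (p r d s y : R) : 0 < y -> 0 < d ->
  tau `](p - d)%R, (r + d)%R[%classic = 0%E -> p <= s -> s <= r ->
  kim tau s y <=
  y * (((1 + 2 * (`|p| + `|r|) ^+ 2) / d ^+ 2 + 2) * fine (tau setT)).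
Proof.
move=> y0 d0 N0 ps sr; rewrite /kim ler_pM2l// -Rintegral_cst//.
apply: (le_Rintegral_off_null _ N0) => //.
- exact: integrable_weight.
- exact: (finite_measure_integrable_cst tau _ measurableT).
move=> x /=; rewrite in_itv/= => /negP; rewrite negb_and -!leNgt => xN.
have D0 := sqd_gt0 s x y0.
have d2 : d ^+ 2 <= (s - x) ^+ 2.
  have [h|h] := orP xN; rewrite !expr2; last rewrite -[leRHS]mulrNN.
    by apply: ler_pM; lra.
  by apply: ler_pM; lra.
have d3 : d ^+ 2 <= sqd s y x by rewrite /sqd; have := sqr_ge0 y; lra.
have sL : s ^+ 2 <= (`|p| + `|r|) ^+ 2.
  rewrite -[s ^+ 2]real_normK ?num_real// lerXn2r ?nnegrE ?addr_ge0//.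
  rewrite ler_norml; have := ler_norm r; have := ler_norm (- p); rewrite normrN.
  by have := normr_ge0 p; have := normr_ge0 r; lra.
rewrite ler_pdivrMr// (le_trans (weight_le s x))// [leRHS]mulrDl; apply: lerD.
  rewrite mulrAC ler_pdivlMr ?exprn_gt0//; apply: ler_pM => //.
  - by have := sqr_ge0 s; lra.
  - exact: sqr_ge0.
  - lra.
by rewrite ler_pM2l// /sqd lerDl sqr_ge0.
Qed.

(** A substitute for a zero of [F] on [E] which does not require [F] to extend to
    the real axis. *)
Definition f_vanishes_on mu (E : set R) := forall e : R, 0 < e ->
  exists y0 : R, 0 < y0 /\ forall y, 0 < y -> y <= y0 ->
    exists s, [/\ E s, `|fre mu s y| <= e & fim mu s y <= e].

Section bp.
Variables (mu : probability B R) (b : R) (tau : {finite_measure set B -> \bar R}).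
Hypothesis bp : boolean_pair mu b tau.

(** An atom of mass [m] gives [m <= - y Im G(u + i y)], and [|F| = 1 / |G|]. *)
Lemma f_vanishes_at_atom (u : R) : mu [set u] != 0%E -> f_vanishes_on mu [set u].
Proof.
move=> mu0 e e0; pose m := fine (mu [set u]).
have mE : mu [set u] = m%:E by rewrite fineK// fin_num_measure.
have m0 : 0 < m by rewrite -lte_fin -mE lt0e mu0 measure_ge0.
exists (m * e); split; first exact: mulr_gt0.
move=> y y0 ye; exists u.
have f0 := fim_gt0 mu u y0.
have := mu_atom_le mu u y0; rewrite mE lee_fin => h.
have gE := gimE mu u y0.
have h2 : m * (fre mu u y ^+ 2 + fim mu u y ^+ 2) <= y * fim mu u y.
  by rewrite -[X in _ <= _ * X]gE mulrA ler_wpM2r// addr_ge0// sqr_ge0.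
have h3 : fim mu u y <= e.
  have : m * fim mu u y <= y.
    rewrite -(ler_pM2r f0); apply: le_trans h2; rewrite -mulrA -expr2 ler_pM2l//.
    by rewrite lerDr sqr_ge0.
  by move=> h4; rewrite -(ler_pM2l m0) (le_trans h4).
split => //.
rewrite -(@ler_pXn2r _ 2)// ?nnegrE ?(ltW e0)// real_normK ?num_real//.
rewrite -(ler_pM2l m0).
apply: (@le_trans _ _ (y * fim mu u y)).
  by apply: le_trans h2; rewrite ler_pM2l// lerDl sqr_ge0.
by rewrite expr2 [leRHS]mulrA; apply: ler_pM; rewrite ?(ltW y0) ?(ltW f0).
Qed.

(** At distance [d] from the support of [tau] one has [Im F = O(y)].  If [|F|]
    stays above a constant on [E] for arbitrarily small [y], then
    [- Im G = Im F / |F|^2 = O(y)] there, so covering [E] by [O(1 / y)] windows of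
    mass [O(y^2)] shows that [E] is null. *)
Lemma f_vanishes_on_charged (p r d : R) (E : set B) :
  0 < d -> tau `](p - d)%R, (r + d)%R[%classic = 0%E ->
  measurable E -> E `<=` `[p, r]%classic -> mu E != 0%E -> f_vanishes_on mu E.
Proof.
move=> d0 N0 mE Epr muE e e0; apply: contrapT => nex.
pose m := fine (mu E).
have mEm : mu E = m%:E by rewrite fineK// fin_num_measure.
have m0 : 0 < m by rewrite -lte_fin -mEm lt0e muE measure_ge0.
have [pr|rp] := leP p r; last first.
  move/eqP : muE; apply; rewrite (_ : E = set0) ?measure0//.
  by rewrite -subset0 => t /Epr /=; rewrite in_itv/=; lra.
pose C := 1 + ((1 + 2 * (`|p| + `|r|) ^+ 2) / d ^+ 2 + 2) * fine (tau setT).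
have C0 : 0 < C.
  have L0 := sqr_ge0 (`|p| + `|r|).
  have A0 : 0 <= (1 + 2 * (`|p| + `|r|) ^+ 2) / d ^+ 2.
    by apply: divr_ge0; [lra|exact: sqr_ge0].
  by rewrite /C ltr_pwDl// mulr_ge0 ?fine_ge0//; lra.
(* [mu E <= K y] will hold whenever [y <= 1]. *)
pose K := (r - p + 2) * (2 * (C / e ^+ 2)).
have Ce : 0 < C / e ^+ 2 by rewrite divr_gt0// exprn_gt0.
have Ce2 : 0 < 2 * (C / e ^+ 2) by lra.
have K0 : 0 < K by apply: mulr_gt0 => //; lra.
apply: nex; exists (Num.min 1 (m / (2 * K))); split.
  by rewrite lt_min ltr01 divr_gt0// mulr_gt0.
move=> y y0; rewrite le_min => /andP[y1 ym].
apply: contrapT => nex.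
have loc s : E s ->
    (mu `[(s - y)%R, (s + y)%R]%classic <= (2 * y * (C * y / e ^+ 2))%:E)%E.
  move=> Es; apply: (le_trans (mu_interval_le mu s y0)).
  rewrite lee_fin ler_pM2l ?mulr_gt0//.
  have f0 := fim_gt0 mu s y0; have gE := gimE mu s y0; have g0 := gim_gt0 mu s y0.
  have fC : fim mu s y <= C * y.
    have [_ ->] := boolean_pairE bp s y0.
    have := Epr _ Es; rewrite /= in_itv/= => /andP[ps sr].
    have := kim_le_off_support y0 d0 N0 ps sr; rewrite /C; lra.
  have e2 : e ^+ 2 <= fre mu s y ^+ 2 + fim mu s y ^+ 2.
    have [h1|h1] := leP `|fre mu s y| e; last first.
      apply: (@le_trans _ _ (fre mu s y ^+ 2)); last by rewrite lerDl sqr_ge0.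
      by rewrite -[leRHS]real_normK ?num_real// lerXn2r ?nnegrE// ltW.
    have [h2|h2] := leP (fim mu s y) e; first by exfalso; apply: nex; exists s.
    apply: (@le_trans _ _ (fim mu s y ^+ 2)); last by rewrite lerDr sqr_ge0.
    by rewrite lerXn2r ?nnegrE// ltW.
  rewrite ler_pdivlMr ?exprn_gt0//; apply: le_trans fC; rewrite -gE ler_wpM2l//.
  exact: ltW.
pose n := (Num.trunc ((r - p) / y)).+1.
have n1 : r - p <= n%:R * y by rewrite -ler_pdivrMr// ltW// truncnS_gt.
have n2 : n%:R * y <= r - p + y.
  rewrite /n -natr1 mulrDl mul1r lerD2r -ler_pdivlMr//.
  by rewrite truncn_le// divr_ge0 ?subr_ge0// ltW.
have Ecov : E `<=` `[p, p + n%:R * y]%classic.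
  by apply: subset_trans Epr _ => t /=; rewrite !in_itv/=; lra.
have cy0 : 0 <= 2 * y * (C * y / e ^+ 2).
  by rewrite mulr_ge0 ?divr_ge0 ?sqr_ge0 ?mulr_ge0// ltW.
have := measure_le_cells cy0 (ltW y0) mE Ecov loc.
rewrite [X in (X <= _)%E]mEm lee_fin.
have -> : n.+1%:R * (2 * y * (C * y / e ^+ 2)) =
    (n%:R * y + y) * (2 * (C / e ^+ 2)) * y.
  by rewrite -natr1; field; rewrite gt_eqF.
have h1 : (n%:R * y + y) * (2 * (C / e ^+ 2)) <= K.
  by rewrite /K ler_pM2r//; lra.
have h2 : (n%:R * y + y) * (2 * (C / e ^+ 2)) * y <= K * y by rewrite ler_pM2r.
have h3 : K * y <= m / 2.
  have : 0 < 2 * K by lra.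
  by move=> K2; move: ym; rewrite ler_pdivlMr//; clear; move: (K) (m) => K' m'; lra.
by move=> h4; lra.
Qed.

(** [Re F] grows by about [c - a] at least between the two sets, so it cannot be
    small on both. *)
Lemma f_vanishes_once (E1 E2 : set R) (a c : R) : a < c ->
  (forall s, E1 s -> s <= a) -> (forall t, E2 t -> c <= t) ->
  (forall s t, E1 s -> E2 t -> tau `]s, t[%classic = 0%E) ->
  f_vanishes_on mu E1 -> f_vanishes_on mu E2 -> False.
Proof.
move=> ac E1a E2c st0 v1 v2.
have [d dE] : {d | d = c - a} by exists (c - a).
have d0 : 0 < d / 4 by lra.
(* With [|Re F|], [Im F] and [y] at most [d / 4], the function [Re F] grows by at
   most [d / 2]; but [kre_diff] makes it grow by at least [3 d / 4]. *)
have [y1 [y10 {}v1]] := v1 _ d0; have [y2 [y20 {}v2]] := v2 _ d0.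
pose y := Num.min (d / 4) (Num.min y1 y2).
have y0 : 0 < y by rewrite !lt_min d0 y10 y20.
have yd : y <= d / 4 by rewrite ge_min lexx.
have yy1 : y <= y1 by rewrite !ge_min lexx !orbT.
have yy2 : y <= y2 by rewrite !ge_min lexx !orbT.
clearbody y.
have [s [Es s1 s2]] := v1 y y0 yy1; have [t [Et t1 t2]] := v2 y y0 yy2.
have sa := E1a _ Es; have ct := E2c _ Et.
have st : s < t by lra.
have := kre_diff y0 st (st0 _ _ Es Et).
have [rs is_] := boolean_pairE bp s y0; have [rt it_] := boolean_pairE bp t y0.
have ts : 0 < t - s by lra.
rewrite [leRHS]mulrAC ler_pdivlMr//.
move: s1 t1; rewrite !ler_norml => /andP[s1 s1'] /andP[t1 t1'] h.
have ks : kim tau s y <= d / 4 by lra.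
have kt : kim tau t y <= d / 4 by lra.
have h2 : 2 * y * (kim tau s y + kim tau t y) <= 2 * (d / 4) * (d / 2).
  apply: ler_pM; try lra.
  by rewrite addr_ge0// kim_ge0.
have h3 : (t - s - d / 2) * (t - s) <= 2 * (d / 4) * (d / 2).
  by apply: le_trans h2; apply: le_trans h; rewrite ler_wpM2r//; lra.
have ds : d <= t - s by lra.
have : d / 2 * d <= (t - s - d / 2) * (t - s) by apply: ler_pM; lra.
nra.
Qed.

(** [J] is an interval whose interior is not charged by [tau], with [z] its
    endpoint and the [[p n, r n]] exhausting its interior.  The endpoint is kept
    apart because [Im F = O(y)] may fail there. *)
Lemma zero_or_dirac_off_support (m : {measure set B -> \bar R}) (J : set B) (z : R)
    (p r d : nat -> R) :
  measurable J -> (forall A, measurable A -> m A = mu (A `&` J)) ->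
  (forall n, 0 < d n) ->
  (forall n, tau `](p n - d n)%R, (r n + d n)%R[%classic = 0%E) ->
  J `<=` [set z] `|` \bigcup_n `[p n, r n]%classic ->
  (forall s t, J s -> J t -> tau `]s, t[%classic = 0%E) ->
  zero_or_dirac_multiple m.
Proof.
move=> mJ mE d0 N0 JU st0.
have van (E : set B) : measurable E -> E `<=` J -> mu E != 0%E -> f_vanishes_on mu E.
  move=> mEE EJ muE.
  have sub (E' : set R) : E' `<=` E -> f_vanishes_on mu E' -> f_vanishes_on mu E.
    move=> E'E v e e0; have [y0 [y00 {}v]] := v e e0; exists y0; split => // y y1 y2.
    by have [s [/E'E Es h1 h2]] := v y y1 y2; exists s.
  have [z0|z0] := eqVneq (mu (E `&` [set z])) 0%E; last first.
    have Ez : E z.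
      apply: contrapT => Ez; move/eqP: z0; apply.
      rewrite (_ : _ `&` _ = set0) ?measure0// -subset0 => t [Et /= tz].
      by apply: Ez; rewrite -tz.
    have Ezz : E `&` [set z] = [set z] by apply: setIidr => t ->.
    by apply: (sub [set z]); [move=> t ->|apply: f_vanishes_at_atom; rewrite -Ezz].
  have [[n nE]|nn] := pselect (exists n, mu (E `&` `[p n, r n]%classic) != 0%E).
    apply: (sub _ (@subIsetl _ _ `[p n, r n]%classic)).
    apply: (@f_vanishes_on_charged (p n) (r n) (d n)) => //; exact: measurableI.
  exfalso; move/eqP: muE; apply.
  apply: (@null_bigcup _ _
    (fun n => (E `&` [set z]) `|` (E `&` `[p n, r n]%classic))) => //.
  - move=> k; apply: measurableU; exact: measurableI.
  - move=> t Et; have [tz|[n _ tn]] := JU _ (EJ _ Et); first by exists 0%N => //; left.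
    by exists n => //; right.
  - move=> k; apply/eqP; rewrite -measure_le0.
    rewrite (le_trans (measureU2 _ _ _))//; [exact: measurableI..|].
    have h0 : mu (E `&` `[p k, r k]%classic) = 0%E.
      by apply: contrapT => /eqP h; apply: nn; exists k.
    by rewrite [X in (X + _)%E]z0 [X in (_ + X)%E]h0 adde0.
apply: zero_or_dirac_of_gap.
  by rewrite mE// setTI (le_lt_trans (probability_le1 mu mJ))// ltry.
move=> a c ac; apply: contrapT => /not_orP[/eqP h1 /eqP h2].
rewrite !mE// in h1 h2.
have mI1 : measurable (`]-oo, a]%classic `&` J) by exact: measurableI.
have mI2 : measurable (`[c, +oo[%classic `&` J) by exact: measurableI.
apply: (f_vanishes_once ac _ _ _ (van _ mI1 (@subIsetr _ _ _) h1)
                                 (van _ mI2 (@subIsetr _ _ _) h2)).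
- by move=> s []; rewrite /= in_itv.
- by move=> t []; rewrite /= in_itv/= andbT.
- by move=> s t [_ Js] [_ Jt]; exact: st0.
Qed.

End bp.
End Outside.

(** * The Levy measure and its density *)

Section Density.
Context {R : realType}.
Local Notation B := (measurableTypeR R).
Local Notation leb := (@lebesgue_measure R).
Variables (mu : probability B R) (k : R -> R).
Variables (nu nu_ac nu_s : {measure set B -> \bar R}) (f : B -> \bar R).
Variables (b : R) (tau : {finite_measure set B -> \bar R}).
Hypothesis bp : boolean_pair mu b tau.
Hypothesis nuE : forall A, measurable A ->
  nu A = (\int[tau]_(x in A `\ 0%R) ((1 + x ^+ 2) / x ^+ 2)%:E)%E.
Hypothesis nu_split : forall A, measurable A -> nu A = (nu_ac A + nu_s A)%E.
Hypothesis nu_s_sing : lebesgue_singular nu_s.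
Hypothesis fdens : is_lebesgue_density nu_ac f.
Hypothesis kf : {ae leb, forall x : R, x != 0 -> (k x)%:E = (`|x|%:E * f x)%E}.

Lemma nu_ge_density (A : set B) (c : R) : measurable A -> 0 <= c ->
  (forall x, A x -> x != 0 /\ c * `|x| <= k x) -> (c%:E * leb A <= nu A)%E.
Proof.
move=> mA c0 Ak; have [mf f0 fE] := fdens.
apply: (@le_trans _ _ (nu_ac A)); last by rewrite nu_split// leeDl.
rewrite fE// -integral_cst//; apply: ae_ge0_le_integral => //.
- exact: measurable_funS mf.
have [N [mN N0 hN]] := kf; exists N; split => // x /= hx.
apply: hN => /= kx; apply: hx => Ax; have [x0 ck] := Ak x Ax.
have nx : 0 < `|x| by rewrite normr_gt0.
have := kx x0; have := f0 x; case: (f x) => [r _|_ _|//]; last by rewrite leey.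
rewrite -EFinM => -[kE]; rewrite lee_fin -(ler_pM2r nx) [leRHS]mulrC -kE.
exact: ck.
Qed.

Lemma nu_ac_null (A : set B) : measurable A ->
  (forall x, A x -> x != 0 /\ k x = 0) -> nu_ac A = 0%E.
Proof.
move=> mA Ak; have [mf f0 fE] := fdens.
rewrite fE//; apply/eqP; rewrite eq_le integral_ge0 ?andbT//.
apply: (@le_trans _ _ (\int[leb]_(x in A) 0)%E); last by rewrite integral0.
apply: ae_ge0_le_integral => //; first exact: measurable_funS mf.
have [N [mN N0 hN]] := kf; exists N; split => // x /= hx.
apply: hN => /= kx; apply: hx => Ax; have [x0 k0] := Ak x Ax.
have nx : 0 < `|x| by rewrite normr_gt0.
have := kx x0; rewrite k0; have := f0 x; case: (f x) => [r _|_|//].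
  by rewrite -EFinM => -[/esym/eqP]; rewrite mulf_eq0 gt_eqF//= => /eqP ->.
by rewrite gt0_muley// lte_fin.
Qed.

Lemma measurable_levy_density (A : set B) : measurable A -> ~ A 0 ->
  measurable_fun A (fun x : B => ((1 + x ^+ 2) / x ^+ 2)%:E : \bar R).
Proof.
move=> mA A0; apply/measurable_EFinP.
have mC : measurable (~` [set 0] : set B).
  by apply: measurableC; exact: measurable_set1.
have sub : A `<=` ~` [set 0].
  by move=> x Ax /= x0; apply: A0; rewrite -x0.
apply: (measurable_funS mC sub).
apply: (@open_continuous_measurable_fun R (~` [set 0])).
  by apply: closed_openC; exact: closed_eq.
move=> x; rewrite inE/= => /eqP x0.
apply: cvgM; last (apply: cvgV; first by rewrite expf_neq0).
  by apply: cvgD; [exact: cvg_cst|exact: exprn_continuous].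
exact: exprn_continuous.
Qed.

(** On [A] the absolutely continuous part of [nu] vanishes with [k].  The singular
    part lives on a null set, which [tau] does not charge off [0], and [nu] and
    [tau] are equivalent off [0]. *)
Lemma tau_null_of_k0 (A : set B) : boolean_selfdecomposable mu ->
  measurable A -> (forall x, A x -> x != 0 /\ k x = 0) -> tau A = 0%E.
Proof.
move=> sd mA Ak; have [N [mN N0 NC]] := nu_s_sing.
have A0 : ~ A 0 by move=> /Ak []; rewrite eqxx.
have tN : tau (A `&` N) = 0%E.
  apply: (tau_null_off0 sd bp); first exact: measurableI.
    by apply: (@null_subset _ _ _ N) => //; exact: measurableI.
  by move=> [].
have nA : nu A = 0%E.
  rewrite nu_split// (nu_ac_null mA Ak) add0e.
  rewrite -(setUIDK A N); apply/eqP; rewrite -measure_le0.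
  rewrite (le_trans (measureU2 _ _ _))//; [exact: measurableI|exact: measurableD|].
  rewrite [X in (X + _)%E](_ : _ = 0%E); last first.
    apply/eqP; rewrite -measure_le0.
    apply: (@le_trans _ _ (nu (A `&` N))).
      by rewrite nu_split ?leeDr//; exact: measurableI.
    rewrite nuE; last exact: measurableI.
    have mAN : measurable ((A `&` N) `\ 0%R).
      by apply: measurableD; [exact: measurableI|exact: measurable_set1].
    rewrite null_set_integral//.
      by apply: measurable_levy_density => // -[[]].
    by apply: (null_subset _ _ _ tN) => //; exact: measurableI.
  rewrite add0e measure_le0; apply/eqP.
  apply: (@null_subset _ _ _ (~` N)) => //; [exact: measurableD|exact: measurableC].
suff : (tau A <= nu A)%E by rewrite nA measure_le0 => /eqP.
rewrite nuE// -[tau A]mul1e -integral_cst//.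
rewrite (_ : A `\ 0%R = A); last first.
  by apply/seteqP; split => [x []//|x Ax]; split => // x0; apply: A0; rewrite -x0.
apply: ge0_le_integral => //.
- exact: measurable_levy_density.
- move=> x Ax; have [x0 _] := Ak x Ax; rewrite lee_fin ler_pdivlMr.
    by rewrite mul1r lerDr.
  by rewrite exprn_even_gt0.
Qed.

(** Both sides are integrals against [tau], and the hypothesis compares the
    integrands on [A]. *)
Lemma nu_le_kim (A : set B) (u y c : R) : 0 < y -> 0 <= c -> measurable A ->
  (forall x, A x -> x != 0 /\ c * sqd u y x <= y * x ^+ 2) ->
  (c%:E * nu A <= (kim tau u y)%:E)%E.
Proof.
move=> y0 c0 mA Ac.
have kE : (kim tau u y)%:E = (\int[tau]_x (y * ((1 + x ^+ 2) / sqd u y x))%:E)%E.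
  rewrite /kim -RintegralZl//; last exact: integrable_weight.
  rewrite /Rintegral fineK//; apply: (integrable_fin_num measurableT).
  by apply: integrable_scaleR; exact: integrable_weight.
have mA0 : measurable (A `\ 0%R : set B) by exact: measurableD.
have mlev : measurable_fun (A `\ 0%R)
    (fun x : B => ((1 + x ^+ 2) / x ^+ 2)%:E : \bar R).
  by apply: measurable_levy_density; [exact: mA0|case=> _; apply].
have lev0 (x : R) : 0 <= (1 + x ^+ 2) / x ^+ 2.
  by rewrite divr_ge0 ?addr_ge0 ?sqr_ge0.
have ker0 (x : R) : 0 <= y * ((1 + x ^+ 2) / sqd u y x).
  by rewrite mulr_ge0 ?divr_ge0 ?addr_ge0 ?sqr_ge0// ltW ?sqd_gt0.
have mker : measurable_fun setT (fun x : B => (y * ((1 + x ^+ 2) / sqd u y x))%:E).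
  apply/measurable_EFinP; apply: measurable_funM => //.
  apply: measurable_funM; last exact: measurable_sqdV.
  by apply: measurable_funD => //; exact: measurable_funX.
rewrite kE nuE// -ge0_integralZl_EFin//; last by move=> x _; rewrite lee_fin.
apply: (@le_trans _ _
  (\int[tau]_(x in A `\ 0%R) (y * ((1 + x ^+ 2) / sqd u y x))%:E)%E).
  apply: ge0_le_integral => //.
  - by move=> x _; rewrite -EFinM lee_fin mulr_ge0.
  - exact: measurable_funeM.
  - exact: measurable_funS mker.
  move=> x [Ax _]; have [x0 h] := Ac x Ax.
  have x2 : 0 < x ^+ 2 by rewrite exprn_even_gt0.
  have D0 := sqd_gt0 u x y0.
  rewrite -EFinM lee_fin mulrCA [leRHS]mulrCA ler_wpM2l//.
    by rewrite addr_ge0 ?sqr_ge0.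
  by rewrite ler_pdivrMr// mulrAC ler_pdivlMr.
by apply: ge0_subset_integral => // x _; rewrite lee_fin.
Qed.

(** The window has Levy mass at least [2 y c], and on it [|z - x|^2 <= 2 y^2]
    while [x^2 >= d^2]. *)
Lemma kim_ge_density (u y d c : R) : 0 < y -> 0 < d -> 0 <= c ->
  (forall x, x \in `[u - y, u + y] -> d <= `|x| /\ c * `|x| <= k x) ->
  d ^+ 2 * c <= kim tau u y.
Proof.
move=> y0 d0 c0 Ik; rewrite -lee_fin.
have := @nu_le_kim `[u - y, u + y]%classic u y (d ^+ 2 / (2 * y)) y0 _ _ _.
have mI : measurable (`[u - y, u + y]%classic : set B) by [].
have q0 : 0 <= d ^+ 2 / (2 * y) by rewrite divr_ge0 ?sqr_ge0// mulr_ge0// ltW.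
move=> /(_ q0 mI) H; apply: (le_trans _ (H _)); last first.
  move=> x /= xI; have [dx _] := Ik x xI; split.
    by rewrite -normr_gt0 (lt_le_trans d0).
  have := sqd_le xI => h; rewrite mulrAC ler_pdivrMr ?mulr_gt0//.
  have -> : y * x ^+ 2 * (2 * y) = x ^+ 2 * (2 * y ^+ 2) by ring.
  apply: ler_pM; rewrite ?sqr_ge0// ?(ltW (sqd_gt0 _ _ _))//.
  rewrite -[leRHS]real_normK ?num_real// lerXn2r ?nnegrE// ltW//.
apply: (@le_trans _ _ ((d ^+ 2 / (2 * y))%:E *
    (c%:E * leb `[(u - y)%R, (u + y)%R]%classic))%E).
  rewrite lebesgue_measure_itv/= lte_fin ifT; last by lra.
  rewrite -EFinD -!EFinM lee_fin [leRHS](_ : _ = d ^+ 2 * c)//.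
  by field; rewrite gt_eqF.
rewrite lee_wpmul2l ?lee_fin//; apply: nu_ge_density => // x xI.
have [dx cx] := Ik x xI; split => //.
by rewrite -normr_gt0 (lt_le_trans d0).
Qed.

(** A lower bound on [Im F] bounds [- Im G <= 1 / Im F] from above. *)
Lemma mu_null_of_k_pos (p r d0 d c : R) (N : set B) :
  0 < d0 -> 0 < d -> 0 < c ->
  (forall x, p - d0 <= x -> x <= r + d0 -> d <= `|x| /\ c * `|x| <= k x) ->
  measurable N -> leb N = 0%E -> N `<=` `[p, r]%classic -> mu N = 0%E.
Proof.
move=> d00 dp c0 Ik; have dc : 0 < d ^+ 2 * c by rewrite mulr_gt0// exprn_gt0.
apply: (@null_of_local_bound _ _ _ _ (d ^+ 2 * c)^-1 d0) => //.
  by rewrite invr_ge0 ltW.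
move=> s y ps sr y0 yd; apply: (le_trans (mu_interval_le mu s y0)).
rewrite lee_fin ler_pM2l ?mulr_gt0//.
have g0 := gim_gt0 mu s y0; have [_ fE] := boolean_pairE bp s y0.
have kd : d ^+ 2 * c <= kim tau s y.
  apply: kim_ge_density => //; first exact: ltW.
  by move=> x; rewrite in_itv/= => /andP[x1 x2]; apply: Ik; lra.
have gf := gim_fim_le1 mu s y0.
rewrite -[leRHS]mul1r ler_pdivlMr//; apply: le_trans gf; rewrite ler_pM2l//; lra.
Qed.

(** [mu {0} <= - y Im G(i y) <= y / Im F(i y)], and outside [(- y, y)] the kernel
    of [Im F(i y) / y] is at least half the density of [nu] against [tau]. *)
Lemma atom0_le (A : set B) (y : R) : 0 < y -> measurable A ->
  (forall x, A x -> y <= `|x|) -> (mu [set 0%R] * nu A <= 2%:E)%E.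
Proof.
move=> y0 mA Ay.
have g0 := gim_gt0 mu 0 y0; have [_ fE] := boolean_pairE bp 0 y0.
have h1 := mu_atom_le mu 0 y0.
have h2 : ((y / 2)%:E * nu A <= (kim tau 0 y)%:E)%E.
  apply: nu_le_kim => //; first by rewrite divr_ge0// ltW.
  move=> x Ax; have yx := Ay x Ax; split.
    by rewrite -normr_gt0 (lt_le_trans y0).
  rewrite mulrAC ler_pdivrMr// -mulrA ler_pM2l// /sqd sub0r sqrrN.
  have : y ^+ 2 <= x ^+ 2.
    by rewrite -[leRHS]real_normK ?num_real// lerXn2r ?nnegrE// ltW.
  lra.
have gf := gim_fim_le1 mu 0 y0.
have gk : gim mu 0 y * kim tau 0 y <= 1.
  by apply: le_trans gf; rewrite ler_pM2l//; lra.
have nuf : nu A = (fine (nu A))%:E.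
  rewrite fineK// ge0_fin_numE//; move: h2.
  case: (nu A) => [r||]//; rewrite ?ltry//.
  by rewrite gt0_muley ?lte_fin ?divr_gt0// leye_eq.
have muf : mu [set 0] = (fine (mu [set 0]))%:E by rewrite fineK// fin_num_measure.
have n0 : 0 <= fine (nu A) by rewrite fine_ge0.
have m0 : 0 <= fine (mu [set 0]) by rewrite fine_ge0.
rewrite nuf muf in h1 h2 *; rewrite -EFinM !lee_fin in h1 h2 *.
have h3 : fine (mu [set 0]) * (y / 2 * fine (nu A)) <= y * gim mu 0 y * kim tau 0 y.
  by apply: ler_pM => //; rewrite mulr_ge0// divr_ge0// ltW.
have h4 : y * (gim mu 0 y * kim tau 0 y) <= y * 1 by rewrite ler_pM2l.
rewrite -(ler_pM2l y0); rewrite -mulrA in h3; lra.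
Qed.

(** The dyadic shells on one side of [0], selected by the sign [(-1) ^+ s], all
    have Levy mass at least [c / 2] because [dx / |x|] is scale invariant. *)
Lemma nu_shell (s : bool) (y c : R) : 0 < y -> 0 < c ->
  (forall x : R, 0 < x -> x <= y -> c <= k ((-1) ^+ s * x)) ->
  exists S : set B, [/\ measurable S,
    forall x, S x -> y / 2 < (-1) ^+ s * x <= y & ((c / 2)%:E <= nu S)%E].
Proof.
move=> y0 c0 kc.
pose S : set B := if s then `[- y, - (y / 2)[%classic else `]y / 2, y]%classic.
have mS : measurable S by rewrite /S; case: (s); exact: measurable_itv.
have Sx (x : R) : S x -> y / 2 < (-1) ^+ s * x <= y.
  rewrite /S; case: (s) => /=; rewrite in_itv/= ?expr1 ?expr0 ?mul1r//.
  by rewrite mulN1r; lra.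
have lS : leb S = (y / 2)%:E.
  rewrite /S; case: (s); rewrite lebesgue_measure_itv/= lte_fin ifT.
  - by rewrite -?EFinN -?EFinD; congr EFin; lra.
  - by lra.
  - by rewrite -?EFinN -?EFinD; congr EFin; lra.
  - by lra.
exists S; split => //.
rewrite (_ : c / 2 = c / y * (y / 2)); last by field; rewrite gt_eqF.
rewrite EFinM -lS; apply: nu_ge_density => //; first by rewrite divr_ge0// ltW.
move=> x /Sx /andP[x1 x2]; have sx : 0 < (-1) ^+ s * x by lra.
have xE : x = (-1) ^+ s * ((-1) ^+ s * x) by rewrite mulrA -expr2 sqrr_sign mul1r.
have nx : `|x| = (-1) ^+ s * x.
  by rewrite {1}xE normrMsign gtr0_norm.
split; first by rewrite -normr_gt0 nx.
rewrite nx {2}xE; apply: le_trans (kc _ sx x2).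
by rewrite mulrAC ler_pdivrMr// ler_pM2l.
Qed.

Lemma nu_dyadic (s : bool) (x1 c : R) n : 0 < x1 -> 0 < c ->
  (forall x : R, 0 < x -> x <= x1 -> c <= k ((-1) ^+ s * x)) ->
  exists (A : set B) (y : R), [/\ measurable A, 0 < y <= x1,
    forall x, A x -> y < (-1) ^+ s * x & ((n%:R * (c / 2))%:E <= nu A)%E].
Proof.
move=> x10 c0 kc; elim: n => [|n [A [y [mA /andP[y0 yx] Ay nA]]]].
  exists set0, x1; split => //; first by rewrite x10 lexx.
  by rewrite mul0r.
have [|S [mS Sy nS]] := nu_shell y0 c0 (s := s).
  by move=> x x0 xy; apply: kc => //; exact: le_trans yx.
exists (A `|` S), (y / 2); split.
- exact: measurableU.
- by apply/andP; split; lra.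
- by move=> x [/Ay|/Sy/andP[]]; lra.
rewrite measureU//; last first.
  by apply/seteqP; split => // x [/Ay h1 /Sy/andP[_ h2]]; move: h1; rewrite ltNge h2.
by rewrite -natr1 mulrDl mul1r EFinD leeD.
Qed.

(** The Levy mass of [A] in atom0_le can be made arbitrarily large. *)
Lemma mu_atom0 (s : bool) (x1 c : R) : 0 < x1 -> 0 < c ->
  (forall x : R, 0 < x -> x <= x1 -> c <= k ((-1) ^+ s * x)) ->
  mu [set 0] = 0%E.
Proof.
move=> x10 c0 kc; apply/eqP; rewrite -measure_le0; apply/lee_addgt0Pr => e e0.
rewrite add0e.
pose n := (Num.trunc (2 / e / (c / 2))).+1.
have nc : 2 / e <= n%:R * (c / 2).
  by rewrite -ler_pdivrMr ?divr_gt0// ltW// truncnS_gt.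
have [A [y [mA /andP[y0 _] Ay nA]]] := nu_dyadic n x10 c0 kc.
have H : (mu [set 0%R] * nu A <= 2%:E)%E.
  apply: (atom0_le y0 mA) => x /Ay h.
  by rewrite -[x](signrMK s) normrMsign (le_trans (ltW h))// ler_norm.
have e2 : 0 < 2 / e by rewrite divr_gt0.
have : (mu [set 0%R] * (2 / e)%:E <= 2%:E)%E.
  apply: le_trans H; rewrite lee_wpmul2l//.
  by apply: le_trans nA; rewrite lee_fin.
rewrite -lee_pdivlMr// => h; apply: (le_trans h); rewrite -EFinM lee_fin.
by rewrite invf_div mulrCA divff ?mulr1.
Qed.

End Density.

(** * The endpoints of the support of k *)

Section Supports.
Context {R : realType}.

(** Lets the cover of [(alpha, beta)] by compact intervals be written once for
    finite and infinite endpoints. *)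
Lemma ereal_approx_below (e : \bar R) : (0 <= e)%E ->
  exists r : nat -> R, (forall n, ((r n)%:E < e)%E) /\
    forall t : R, (t%:E < e)%E -> exists n0, forall n, (n0 <= n)%N -> t <= r n.
Proof.
case: e => [x|_|//]; last first.
  exists (fun n => n%:R); split=> [n|t _]; first exact: ltry.
  exists (Num.trunc `|t|).+1 => n h.
  by rewrite (le_trans (ler_norm _))// (le_trans (ltW (truncnS_gt _)))// ler_nat.
move=> _; exists (fun n => x - n.+1%:R^-1); split=> [n|t].
  by rewrite lte_fin ltrBlDr ltrDl invr_gt0 ltr0n.
rewrite lte_fin => tx; exists (Num.trunc (x - t)^-1) => n h.
rewrite lerBrDl -lerBrDr invf_ple ?posrE ?subr_gt0 ?ltr0n//.
by rewrite (le_trans (ltW (truncnS_gt _)))// ler_nat ltnS.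
Qed.

Variable k : R -> R.
Hypothesis k_unimodal : unimodal0 k.
Hypothesis k_ge0 : forall x, x != 0 -> 0 <= k x.

(** Unimodality, stated for both half-lines at once: [(-1) ^+ s * x] runs through
    the right one for [s = false] and the left one for [s = true]. *)
Lemma k_side (s : bool) (x x1 : R) : 0 < x -> x <= x1 ->
  k ((-1) ^+ s * x1) <= k ((-1) ^+ s * x).
Proof.
move=> x0 xx1; have x10 : 0 < x1 by exact: lt_le_trans xx1.
case: s; rewrite ?expr1 ?expr0 ?mul1r ?mulN1r.
  by apply: (k_unimodal.1); rewrite ?in_itv/= ?oppr_lt0// lerN2.
by apply: (k_unimodal.2); rewrite ?in_itv/= ?andbT.
Qed.

Lemma k_zero_right (x : R) : (k_sup k < x%:E)%E -> x != 0 -> k x = 0.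
Proof.
move=> sx x0; apply: contrapT => /eqP kx; move: sx; apply/negP; rewrite -leNgt.
by apply: ereal_sup_ubound; exists x.
Qed.

Lemma k_zero_left (x : R) : (x%:E < k_inf k)%E -> x != 0 -> k x = 0.
Proof.
move=> sx x0; apply: contrapT => /eqP kx; move: sx; apply/negP; rewrite -leNgt.
by apply: ereal_inf_lbound; exists x.
Qed.

Hypothesis k_neq0 : exists x : R, x != 0 /\ k x != 0.

Lemma k_neq0_side : exists (s : bool) (x1 : R),
  0 < x1 /\ forall x, 0 < x -> x <= x1 ->
    k ((-1) ^+ s * x1) <= k ((-1) ^+ s * x) /\ 0 < k ((-1) ^+ s * x1).
Proof.
have [x [x0 kx]] := k_neq0.
exists (x < 0), `|x|; split; first by rewrite normr_gt0.
move=> t t0 tx; split; first exact: k_side.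
by rewrite -numEsign lt0r kx k_ge0.
Qed.

(** If [k] does not vanish at some negative point, it does not vanish between
    this point and [0] either. *)
Lemma k_sup_ge0 : (0 <= k_sup k)%E.
Proof.
have [s [x1 [x10 H]]] := k_neq0_side.
have sup_ge (x : R) : 0 < x -> x <= x1 -> (((-1) ^+ s * x)%:E <= k_sup k)%E.
  move=> x0 xx1; have [h1 h2] := H _ x0 xx1.
  apply: ereal_sup_ubound; exists ((-1) ^+ s * x) => //; split.
    by rewrite mulf_neq0 ?signr_eq0// gt_eqF.
  by rewrite gt_eqF// (lt_le_trans h2).
case: s H sup_ge => H; rewrite ?expr1 ?expr0 => sup_ge; last first.
  by apply: le_trans (sup_ge _ x10 (lexx _)); rewrite mul1r lee_fin ltW.
apply/lee_subgt0Pr => e e0.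
apply: (@le_trans _ _ ((-1 * Num.min e x1)%:E)).
  by rewrite sub0e -EFinN lee_fin mulN1r lerN2 ge_min lexx.
by apply: sup_ge; [rewrite lt_min e0|rewrite ge_min lexx orbT].
Qed.

Lemma k_inf_le0 : (k_inf k <= 0)%E.
Proof.
have [s [x1 [x10 H]]] := k_neq0_side.
have inf_le (x : R) : 0 < x -> x <= x1 -> (k_inf k <= ((-1) ^+ s * x)%:E)%E.
  move=> x0 xx1; have [h1 h2] := H _ x0 xx1.
  apply: ereal_inf_lbound; exists ((-1) ^+ s * x) => //; split.
    by rewrite mulf_neq0 ?signr_eq0// gt_eqF.
  by rewrite gt_eqF// (lt_le_trans h2).
case: s H inf_le => H; rewrite ?expr1 ?expr0 => inf_le.
  by apply: le_trans (inf_le _ x10 (lexx _)) _; rewrite mulN1r lee_fin oppr_le0 ltW.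
apply/lee_addgt0Pr => e e0; rewrite add0e.
apply: (@le_trans _ _ ((1 * Num.min e x1)%:E)).
  by apply: inf_le; [rewrite lt_min e0|rewrite ge_min lexx orbT].
by rewrite lee_fin mul1r ge_min lexx.
Qed.

End Supports.

(** * Atoms and the singular continuous part *)

Section Atoms.
Context {R : realType}.
Local Notation B := (measurableTypeR R).
Local Notation leb := (@lebesgue_measure R).

Lemma zero_or_dirac_null_off (m : {measure set B -> \bar R}) :
  zero_or_dirac_multiple m -> exists a : R, m (~` [set a]) = 0%E.
Proof.
move=> [m0|[a [c [c0 mE]]]].
  by exists 0; apply: m0; apply: measurableC; exact: measurable_set1.
exists a; rewrite mE; last by apply: measurableC; exact: measurable_set1.
by rewrite diracE memNset ?mule0//; exact.
Qed.

Variables (mu : probability B R) (M E1 E2 : set B).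
Hypotheses (mM : measurable M) (mE1 : measurable E1) (mE2 : measurable E2).
Hypothesis cover : setT `<=` E1 `|` M `|` E2.
Hypothesis mu_ac : forall A, measurable A -> leb A = 0%E -> mu (A `&` M) = 0%E.
Hypothesis E1at : exists a, mu (~` [set a] `&` E1) = 0%E.
Hypothesis E2at : exists a, mu (~` [set a] `&` E2) = 0%E.

Let measurable_C1 (a : R) : measurable (~` [set a] : set B).
Proof. by apply: measurableC; exact: measurable_set1. Qed.

Lemma atoms_le2 : (atoms mu #<= `I_2)%card.
Proof.
have [a ha] := E1at; have [a' ha'] := E2at.
have sub : atoms mu `<=` [set (if n == 0%N then a else a') | n in `I_2].
  move=> x /= xat; apply: contrapT => xN.
  have xa : x != a by apply/eqP => xa; apply: xN; exists 0%N.
  have xa' : x != a' by apply/eqP => xa'; apply: xN; exists 1%N.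
  move/eqP : xat; apply.
  have mx : measurable ([set x] : set B) by exact: measurable_set1.
  have [[E1x|Mx]|E2x] := cover (I : setT x).
  - apply: (null_subset mx _ _ ha); first exact: measurableI.
    by move=> t ->; split => //; apply/eqP.
  - rewrite -(mu_ac mx (lebesgue_measure_set1 x)); congr (mu _).
    by rewrite setIidl// => t ->.
  - apply: (null_subset mx _ _ ha'); first exact: measurableI.
    by move=> t ->; split => //; apply/eqP.
exact: card_le_trans (subset_card_le sub) (card_image_le _ _).
Qed.

Lemma singular_continuous_part_null (m : {measure set B -> \bar R}) :
  is_singular_continuous_part mu m <-> (forall A, measurable A -> m A = 0%E).
Proof.
have [a ha] := E1at; have [a' ha'] := E2at.
split=> [[[N [mN N0 NC]] noat [m_ac [m_d [_ _ muE]]]] A mA|m0]; last first.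
  split.
  - by exists set0; split => //; rewrite ?measure0// setC0 m0.
  - by move=> x; apply: m0; exact: measurable_set1.
  exists (mrestr mu mM), (mrestr mu (measurableC mM)); split.
  - by apply/null_content_dominatesP => A mA A0; exact: mu_ac.
  - exists [set a; a']; split.
      by apply: finite_set_countable; exact: finite_set2.
    change (mu (~` [set a; a'] `&` ~` M) = 0%E).
    apply: (@null_subset _ _ _ ((~` [set a] `&` E1) `|` (~` [set a'] `&` E2))).
    + apply: measurableI; apply: measurableC => //.
      by apply: measurableU; exact: measurable_set1.
    + by apply: measurableU; exact: measurableI.
    + move=> t [/= /not_orP[ta ta'] tM].
      by have [[E1t|//]|E2t] := cover (I : setT t); [left|right].
    apply/eqP; rewrite -measure_le0 (le_trans (measureU2 _ _ _))//;
      [exact: measurableI..|].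
    by rewrite [X in (X + _)%E]ha [X in (_ + X)%E]ha' adde0.
  move=> A mA; rewrite m0// adde0.
  change (mu A = (mu (A `&` M) + mu (A `&` ~` M))%E).
  rewrite -measureU//;
    [|exact: measurableI|apply: measurableI => //; exact: measurableC|].
    by rewrite -setIUr setUv setIT.
  by rewrite setIACA setICr setI0.
have m_le (A' : set B) : measurable A' -> mu A' = 0%E -> m A' = 0%E.
  move=> mA' A'0; apply/eqP; rewrite -measure_le0 -A'0 muE//.
  by rewrite -addeA (le_trans _ (leeDr _ _))// ?leeDl.
have mNC : measurable (~` N) by exact: measurableC.
(* Each piece is null for [m]: the first as [m] is singular, the two points as
   [m] has no atom, the others because [m <= mu]. *)
pose F (n : nat) : set B := nth set0 [:: ~` N; [set a]; [set a'];
  ~` [set a] `&` E1; N `&` M; ~` [set a'] `&` E2] n.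
apply: (@null_bigcup _ _ F) => //.
- move=> [|[|[|[|[|[|n]]]]]]; rewrite /F/= ?nth_nil//; exact: measurableI.
- move=> t _.
  have [Nt|Nt] := pselect (N t); last by exists 0%N.
  have [ta|ta] := eqVneq t a; first by exists 1%N.
  have [ta'|ta'] := eqVneq t a'; first by exists 2%N.
  have [[E1t|Mt]|E2t] := cover (I : setT t).
  - by exists 3%N => //=; split => //; apply/eqP.
  - by exists 4%N.
  - by exists 5%N => //=; split => //; apply/eqP.
- move=> [|[|[|[|[|[|n]]]]]]; rewrite /F/= ?nth_nil ?measure0//.
  - by apply: m_le => //; exact: measurableI.
  - by apply: m_le; [exact: measurableI|exact: mu_ac].
  - by apply: m_le => //; exact: measurableI.
Qed.

End Atoms.

(** * The three parts of the line *)

Section Trichotomy.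
Context {R : realType}.
Local Notation B := (measurableTypeR R).
Local Notation leb := (@lebesgue_measure R).
Variables (mu : probability B R) (k : R -> R).
Hypothesis k_unimodal : unimodal0 k.
Hypothesis k_ge0 : forall x, x != 0 -> 0 <= k x.
Hypothesis k_neq0 : exists x : R, x != 0 /\ k x != 0.

Section inside.
Hypothesis local_null : forall (p r d0 d c : R) (N : set B),
  0 < d0 -> 0 < d -> 0 < c ->
  (forall x, p - d0 <= x -> x <= r + d0 -> d <= `|x| /\ c * `|x| <= k x) ->
  measurable N -> leb N = 0%E -> N `<=` `[p, r]%classic -> mu N = 0%E.

(** By unimodality [k] is at least [k ((-1) ^+ s * x1)] between [0] and that
    point, which leaves room on both sides of [N]. *)
Lemma mu_null_side (s : bool) (p r x1 : R) (N : set B) :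
  0 < p -> p <= r -> r < x1 -> k ((-1) ^+ s * x1) != 0 ->
  measurable N -> leb N = 0%E ->
  (forall x, N x -> p <= (-1) ^+ s * x <= r) -> mu N = 0%E.
Proof.
move=> p0 pr rx1 kx1 mN N0 Npr.
have x10 : 0 < x1 by lra.
have c0 : 0 < k ((-1) ^+ s * x1).
  by rewrite lt0r kx1 k_ge0// mulf_neq0 ?signr_eq0// gt_eqF.
pose d0 := Num.min (p / 2) (x1 - r).
have d00 : 0 < d0 by rewrite lt_min divr_gt0//= subr_gt0.
have d0p : d0 <= p / 2 by rewrite ge_min lexx.
have d0r : d0 <= x1 - r by rewrite ge_min lexx orbT.
have p20 : 0 < p / 2 by rewrite divr_gt0.
have cx0 : 0 < k ((-1) ^+ s * x1) / x1 by rewrite divr_gt0.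
have main (x : R) : p - d0 <= (-1) ^+ s * x -> (-1) ^+ s * x <= r + d0 ->
    p / 2 <= `|x| /\ k ((-1) ^+ s * x1) / x1 * `|x| <= k x.
  move=> h1 h2; have sx0 : 0 < (-1) ^+ s * x by lra.
  have nx : `|x| = (-1) ^+ s * x.
    by rewrite -{1}[x](signrMK s) normrMsign gtr0_norm.
  have sx1 : (-1) ^+ s * x <= x1 by lra.
  split; first by rewrite nx; lra.
  have := k_side k_unimodal s sx0 sx1; rewrite signrMK; apply: le_trans.
  by rewrite nx mulrAC ler_pdivrMr// ler_pM2l.
case: s kx1 c0 cx0 main Npr; rewrite ?expr1 ?expr0 => kx1 c0 cx0 main Npr.
  apply: (local_null (p := - r) (r := - p) d00 p20 cx0) => //.
    by move=> x h1 h2; apply: main; rewrite mulN1r; lra.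
  by move=> x /Npr; rewrite /= in_itv/= mulN1r; lra.
apply: (local_null (p := p) (r := r) d00 p20 cx0) => //.
  by move=> x h1 h2; apply: main; rewrite mul1r.
by move=> x /Npr; rewrite /= in_itv/= mul1r.
Qed.

Hypothesis mu0 : mu [set 0] = 0%E.

Lemma mu_ac_inside (A : set B) : measurable A -> leb A = 0%E ->
  mu (A `&` real_itv `]k_inf k, k_sup k[) = 0%E.
Proof.
move=> mA A0.
have [rr [rr1 rr2]] := ereal_approx_below (k_sup_ge0 k_unimodal k_ge0 k_neq0).
have : (0 <= - k_inf k)%E by rewrite leeNr oppe0; exact: k_inf_le0.
move=> /ereal_approx_below[rl [rl1 rl2]].
pose F (s : bool) (n : nat) : set B :=
  if s then `[- rl n, - n.+1%:R^-1]%classic else `[n.+1%:R^-1, rr n]%classic.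
have mF s n : measurable (F s n) by case: s; exact: measurable_itv.
have FN s n : mu (A `&` F s n) = 0%E.
  have mAF : measurable (A `&` F s n) by exact: measurableI.
  have AF0 : leb (A `&` F s n) = 0%E.
    by apply: (null_subset mAF mA) => //; exact: subIsetl.
  have n0 : 0 < n.+1%:R^-1 :> R by rewrite invr_gt0 ltr0n.
  have [re|rne] := ltP (if s then rl n else rr n) n.+1%:R^-1.
    rewrite (_ : _ `&` _ = set0) ?measure0// -subset0 => x [_].
    move: re; rewrite /F; case: (s) => /= re; rewrite in_itv/= => /andP[h1 h2].
      by move: (le_trans h1 h2); rewrite lerN2 leNgt re.
    by move: (le_trans h1 h2); rewrite leNgt re.
  have [x1 [rx1 kx1]] : exists x1,
      (if s then rl n else rr n) < x1 /\ k ((-1) ^+ s * x1) != 0.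
    case: s {mAF AF0 rne}.
      have := rl1 n; rewrite lteNr => /ereal_inf_lt[_ [x [x0 kx] <-]].
      rewrite -EFinN lte_fin => h; exists (- x); split; first by rewrite ltrNr.
      by rewrite expr1 mulrNN mul1r.
    have /ereal_sup_gt[_ [x [x0 kx] <-]] := rr1 n.
    by rewrite lte_fin => h; exists x; rewrite expr0 mul1r.
  apply: (mu_null_side n0 rne rx1 kx1) => // x [_].
  rewrite /F; case: (s) => /=; rewrite in_itv/= ?expr1 ?expr0 ?mulN1r ?mul1r//.
  by move=> /andP[h1 h2]; rewrite lerNr h2 lerNl.
have mAJ : measurable (A `&` real_itv `]k_inf k, k_sup k[).
  by apply: measurableI => //; exact: measurable_real_itv.
pose G (n : nat) : set B := [set 0] `|` (A `&` F true n `|` A `&` F false n).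
apply: (@null_bigcup _ _ G) => //.
- move=> n; apply: measurableU; first exact: measurable_set1.
  by apply: measurableU; exact: measurableI.
- move=> t [At]; rewrite /real_itv /= in_itv/= => /andP[t1 t2].
  have [tp|tn|t0] := ltrgt0P t.
  + have [n0 h0] := rr2 _ t2.
    pose n := maxn n0 (Num.trunc t^-1).
    exists n => //; right; right; split => //.
    rewrite /F /= in_itv/= h0 ?leq_maxl// andbT.
    rewrite invf_ple ?posrE ?ltr0n//.
    by rewrite (le_trans (ltW (truncnS_gt _)))// ler_nat ltnS leq_maxr.
  + have t1' : ((- t)%:E < - k_inf k)%E by rewrite EFinN lteN2.
    have [n0 h0] := rl2 _ t1'.
    pose n := maxn n0 (Num.trunc (- t)^-1).
    exists n => //; right; left; split => //.
    have nt : 0 < - t by rewrite oppr_gt0.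
    rewrite /F /= in_itv/= lerNl h0 ?leq_maxl//= lerNr.
    rewrite invf_ple ?posrE ?ltr0n//.
    by rewrite (le_trans (ltW (truncnS_gt _)))// ler_nat ltnS leq_maxr.
  + by exists 0%N => //; left.
- move=> n; apply/eqP; rewrite -measure_le0 (le_trans (measureU2 _ _ _))//.
    by apply: measurableU; exact: measurableI.
  rewrite [X in (X + _)%E]mu0 add0e (le_trans (measureU2 _ _ _))//;
    [exact: measurableI..|].
  by rewrite [X in (X + _)%E](FN true n) [X in (_ + X)%E](FN false n) adde0.
Qed.
End inside.

Section outside.
Variables (b : R) (tau : {finite_measure set B -> \bar R}).
Hypothesis bp : boolean_pair mu b tau.
Hypothesis tau_null : forall A : set B, measurable A ->
  (forall x, A x -> x != 0 /\ k x = 0) -> tau A = 0%E.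

Lemma zero_or_dirac_right : (k_sup k < +oo)%E ->
  zero_or_dirac_multiple (restrict_to_itv mu `[k_sup k, +oo[).
Proof.
have := k_sup_ge0 k_unimodal k_ge0 k_neq0.
case supE : (k_sup k) => [z||]// z0 _; rewrite lee_fin in z0.
have JE (x : R) : real_itv `[z%:E, +oo[ x <-> z <= x.
  by rewrite /real_itv /= in_itv/= andbT lee_fin.
have tau0 (s t : R) : z <= s -> tau `]s, t[%classic = 0%E.
  move=> zs; apply: tau_null => // x /=; rewrite in_itv/= => /andP[sx _].
  have zx : z < x by exact: le_lt_trans sx.
  have x0 : x != 0 by rewrite gt_eqF// (le_lt_trans z0).
  by split => //; apply: k_zero_right => //; rewrite supE lte_fin.
have n0 (n : nat) : 0 < n.+1%:R^-1 :> R by rewrite invr_gt0 ltr0n.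
apply: (@zero_or_dirac_off_support R mu b tau bp _ (real_itv `[z%:E, +oo[) z
  (fun n => z + n.+1%:R^-1) (fun n => z + n.+1%:R) (fun n => n.+1%:R^-1)) => //.
- exact: measurable_real_itv.
- by move=> n; apply: tau0; rewrite addrK.
- move=> t /JE; rewrite le_eqVlt => /predU1P[->|zt]; [by left|right].
  pose n := maxn (Num.trunc (t - z)) (Num.trunc (t - z)^-1).
  have tz : 0 < t - z by rewrite subr_gt0.
  exists n => //=; rewrite in_itv/= -lerBrDl -[X in _ && X]lerBlDl.
  apply/andP; split.
    rewrite invf_ple ?posrE ?ltr0n//.
    by rewrite (le_trans (ltW (truncnS_gt _)))// ler_nat ltnS leq_maxr.
  by rewrite (le_trans (ltW (truncnS_gt _)))// ler_nat ltnS leq_maxl.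
- by move=> s t /JE zs _; exact: tau0.
Qed.

Lemma zero_or_dirac_left : (-oo < k_inf k)%E ->
  zero_or_dirac_multiple (restrict_to_itv mu `]-oo, k_inf k]).
Proof.
have := k_inf_le0 k_unimodal k_ge0 k_neq0.
case infE : (k_inf k) => [z||]// z0 _; rewrite lee_fin in z0.
have JE (x : R) : real_itv `]-oo, z%:E] x <-> x <= z.
  by rewrite /real_itv /= in_itv/= lee_fin.
have tau0 (s t : R) : t <= z -> tau `]s, t[%classic = 0%E.
  move=> tz; apply: tau_null => // x /=; rewrite in_itv/= => /andP[_ xt].
  have xz : x < z by exact: lt_le_trans tz.
  have x0 : x != 0 by rewrite lt_eqF// (lt_le_trans xz).
  by split => //; apply: k_zero_left => //; rewrite infE lte_fin.
have n0 (n : nat) : 0 < n.+1%:R^-1 :> R by rewrite invr_gt0 ltr0n.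
apply: (@zero_or_dirac_off_support R mu b tau bp _ (real_itv `]-oo, z%:E]) z
  (fun n => z - n.+1%:R) (fun n => z - n.+1%:R^-1) (fun n => n.+1%:R^-1)) => //.
- exact: measurable_real_itv.
- by move=> n; apply: tau0; rewrite subrK.
- move=> t /JE; rewrite le_eqVlt => /predU1P[->|tz]; [by left|right].
  pose n := maxn (Num.trunc (z - t)) (Num.trunc (z - t)^-1).
  have zt : 0 < z - t by rewrite subr_gt0.
  exists n => //=; rewrite in_itv/=; apply/andP; split.
    rewrite lerBlDr -lerBlDl.
    by rewrite (le_trans (ltW (truncnS_gt _)))// ler_nat ltnS leq_maxl.
  rewrite lerBrDr -lerBrDl invf_ple ?posrE ?ltr0n//.
  by rewrite (le_trans (ltW (truncnS_gt _)))// ler_nat ltnS leq_maxr.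
- by move=> s t _ /JE tz; exact: tau0.
Qed.

End outside.
End Trichotomy.

Unset Implicit Arguments.

Theorem theorem3p9 (R : realType) (mu : probability (measurableTypeR R) R)
    (k : R -> R)
    (mu_selfdec : boolean_selfdecomposable mu)
    (k_mu : is_k_function mu k)
    (k_unimodal : unimodal0 k)
    (k_neq0 : exists x : R, x != 0 /\ k x != 0) :
  [/\ restrict_to_itv mu `]k_inf k, k_sup k[ `<< (@lebesgue_measure R),
      ((-oo < k_inf k)%E ->
         zero_or_dirac_multiple (restrict_to_itv mu `]-oo, k_inf k])) /\
      ((k_sup k < +oo)%E ->
         zero_or_dirac_multiple (restrict_to_itv mu `[k_sup k, +oo[)),
      mu [set 0] = 0%E,
      (forall m : {measure set (measurableTypeR R) -> \bar R},
         is_singular_continuous_part mu m <->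
         (forall A, measurable A -> m A = 0%E)) &
      (atoms mu #<= `I_2)%card].
Proof.
have [nu [nu_ac [f [levy ac_part fdens k_ge0 kf]]]] := k_mu.
have [b [tau [bp nuE]]] := levy.
have [_ [nu_s [nu_sing nu_split]]] := ac_part.
have mu0 : mu [set 0] = 0%E.
  have [s [x1 [x10 kx1]]] := k_neq0_side k_unimodal k_ge0 k_neq0.
  apply: (mu_atom0 bp nuE nu_split fdens kf (s := s) x10 (c := k ((-1) ^+ s * x1))).
    by have [] := kx1 _ x10 (lexx _).
  by move=> x x0 xx1; have [] := kx1 _ x0 xx1.
have tau0 (A : set (measurableTypeR R)) : measurable A ->
    (forall x, A x -> x != 0 /\ k x = 0) -> tau A = 0%E.
  by move=> mA Ak; exact: (tau_null_of_k0 bp nuE nu_split nu_sing fdens kf).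
have inside := mu_ac_inside k_unimodal k_ge0 k_neq0
  (mu_null_of_k_pos bp nuE nu_split fdens kf) mu0.
have left := zero_or_dirac_left k_unimodal k_ge0 k_neq0 bp tau0.
have right := zero_or_dirac_right k_unimodal k_ge0 k_neq0 bp tau0.
have mM := measurable_real_itv `]k_inf k, k_sup k[.
have mL := measurable_real_itv `]-oo, k_inf k].
have mR := measurable_real_itv `[k_sup k, +oo[.
have cover : setT `<=` real_itv `]-oo, k_inf k] `|` real_itv `]k_inf k, k_sup k[
    `|` real_itv `[k_sup k, +oo[.
  move=> x _; rewrite /real_itv /= !in_itv/= andbT.
  have [h1|h1] := leP x%:E (k_inf k); first by left; left.
  by have [h2|h2] := leP (k_sup k) x%:E; [right|left; right].
have atL : exists a, mu (~` [set a] `&` real_itv `]-oo, k_inf k]) = 0%E.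
  have [infE|inf_fin] := eqVneq (k_inf k) -oo%E; last first.
    by apply: (zero_or_dirac_null_off (left _)); rewrite ltNye.
  exists 0; rewrite (_ : _ `&` _ = set0) ?measure0// -subset0 => x [_].
  by rewrite /real_itv /= in_itv/= infE leeNy_eq.
have atR : exists a, mu (~` [set a] `&` real_itv `[k_sup k, +oo[) = 0%E.
  have [supE|sup_fin] := eqVneq (k_sup k) +oo%E; last first.
    by apply: (zero_or_dirac_null_off (right _)); rewrite ltey.
  exists 0; rewrite (_ : _ `&` _ = set0) ?measure0// -subset0 => x [_].
  by rewrite /real_itv /= in_itv/= andbT supE leye_eq.
split => //.
- by apply/null_content_dominatesP => A mA A0; exact: inside.
- by move=> m; exact: (singular_continuous_part_null mM mL mR cover inside atL atR).
- exact: (atoms_le2 mL mR cover inside atL atR).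
Qed.
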